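(* Let $\mathcal E$ be a nonlinear order preserving form on $L^2(\mu)$. The following are equivalent: (i) there exists a measurable $g\colon X\to(0,\infty)$ with $Gg<\infty$ $\mu$-a.e.; (ii) there exists a measurable $w\colon X\to(0,\infty)$ such that $\int_X|f|w\,d\mu\le\|f\|_L$ for all $f\in M(\mathcal E)$. If $\mathcal E_e$ exists, then the inequality in (ii) extends to all $f\in M(\mathcal E_e)$ with $\|\cdot\|_L$ replaced by $\|\cdot\|_{L_e}$.
   Context: $(X,\mathfrak A,\mu)$ is $\sigma$-finite. A nonlinear order preserving form is a lower semicontinuous convex $\mathcal E\colon L^2(\mu)\to[0,\infty]$ with $\mathcal E(-f)=\mathcal E(f)$, $\mathcal E(0)=0$ and $\mathcal E(f+|g|)+\mathcal E(f-|g|)\le\mathcal E(f+g)+\mathcal E(f-g)$ for all $f,g$. $M(\mathcal E)=\{f:\lim_{\lambda\to0+}\mathcal E(\lambda f)=0\}$, $\|f\|_L=\inf\{\lambda>0:\mathcal E(\lambda^{-1}f)\le1\}$. Resolvent: $G_\alpha f$ is the unique minimizer of $g\mapsto\mathcal E(g)+\frac\alpha2\|g-\alpha^{-1}f\|_2^2$; extended to nonnegative measurable $[0,\infty]$-valued functions by monotone limits; Green operator $Gf=\lim_{\alpha\to0+}G_\alpha f$. $\mathcal E_e$ (if it exists) is the lower semicontinuous relaxation on $L^0(\mu)$ w.r.t. local convergence in measure of $\mathcal E$ extended by $+\infty$, existing when $\mathcal E$ is lower semicontinuous on $D(\mathcal E)$ for this convergence; $M(\mathcal E_e)$ and $\|\cdot\|_{L_e}$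 are its modular space and Luxemburg seminorm, defined as for $\mathcal E$. *)

(* Defs.v *)
From HB Require Import structures.
From mathcomp Require Import all_boot all_order all_algebra.
From mathcomp Require Import all_classical all_reals all_analysis.
Set Implicit Arguments. Unset Strict Implicit. Unset Printing Implicit Defensive.
Import Order.TTheory GRing.Theory Num.Theory.
Import numFieldNormedType.Exports.
Local Open Scope classical_set_scope.
Local Open Scope ring_scope.

Section Defs.
Context {d : measure_display} {X : measurableType d} {R : realType}
  (mu : {measure set X -> \bar R}).

Definition L2 (f : X -> R) : Prop :=
  measurable_fun setT f /\ (\int[mu]_x ((f x) ^+ 2)%:E < +oo)%E.

Definition dist2 (f g : X -> R) : \bar R := \int[mu]_x ((f x - g x) ^+ 2)%:E.

(* E : L^2(mu) -> [0,oo], represented on representatives; its values on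
   functions outside L2 are irrelevant (never used). *)
Record nonlinear_order_preserving_form (E : (X -> R) -> \bar R) : Prop := {
  nopf_ae : forall f g, L2 f -> L2 g -> {ae mu, forall x, f x = g x} -> E f = E g;
  nopf_ge0 : forall f, L2 f -> (0 <= E f)%E;
  nopf_lsc : forall (fn : nat -> X -> R) f, (forall n, L2 (fn n)) -> L2 f ->
      (fun n => dist2 (fn n) f) @ \oo --> 0%E ->
      (E f <= limn_einf (fun n => E (fn n)))%E;
  nopf_convex : forall f g (t : R), L2 f -> L2 g -> 0 <= t <= 1 ->
      (E (fun x => t * f x + (1 - t) * g x)%R <= t%:E * E f + (1 - t)%:E * E g)%E;
  nopf_sym : forall f, L2 f -> E (fun x => - f x) = E f;
  nopf_0 : E (fun _ => 0) = 0%E;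
  nopf_order : forall f g, L2 f -> L2 g ->
      (E (fun x => f x + `|g x|)%R + E (fun x => f x - `|g x|)%R
        <= E (fun x => f x + g x)%R + E (fun x => f x - g x)%R)%E
}.

Definition modular_space (D : (X -> R) -> Prop) (F : (X -> R) -> \bar R) :
    set (X -> R) :=
  [set f | D f /\ (fun l : R => F (fun x => l * f x)) @ 0^'+ --> 0%E].

(* Luxemburg (semi)norm: inf {l > 0 | F (l^-1 f) <= 1} (inf of empty = +oo). *)
Definition luxemburg (F : (X -> R) -> \bar R) (f : X -> R) : \bar R :=
  ereal_inf [set l%:E | l in [set l : R | 0 < l /\ (F (fun x => l^-1 * f x)%R <= 1)%E]].

(* g is the (unique) minimizer of h |-> E h + alpha/2 ||h - alpha^-1 f||_2^2,
   i.e. g = G_alpha f, for f in L^2. *)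
Definition is_resolvent (E : (X -> R) -> \bar R) (alpha : R) (f g : X -> R) : Prop :=
  L2 g /\ forall h, L2 h ->
    (E g + (alpha / 2)%R%:E * dist2 g (fun x => alpha^-1 * f x)%R
      <= E h + (alpha / 2)%R%:E * dist2 h (fun x => alpha^-1 * f x)%R)%E.

Definition is_resolvent_ext (E : (X -> R) -> \bar R) (alpha : R)
    (f : X -> \bar R) (u : X -> \bar R) : Prop :=
  forall (fn gn : nat -> X -> R),
    (forall n, L2 (fn n)) ->
    (forall n x, 0 <= fn n x <= fn n.+1 x) ->
    (forall x, (fun n => (fn n x)%:E) @ \oo --> f x) ->
    (forall n, is_resolvent E alpha (fn n) (gn n)) ->
    {ae mu, forall x, (fun n => (gn n x)%:E) @ \oo --> u x}.

Definition is_green (E : (X -> R) -> \bar R) (f : X -> \bar R) (v : X -> \bar R) : Prop :=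
  exists u : R -> X -> \bar R,
    (forall alpha, 0 < alpha -> is_resolvent_ext E alpha f (u alpha)) /\
    forall a : nat -> R, (forall n, 0 < a n) -> a @ \oo --> 0%R ->
      {ae mu, forall x, (fun n => u (a n) x) @ \oo --> v x}.

Definition loc_cvg_meas (fn : nat -> X -> R) (f : X -> R) : Prop :=
  forall A, measurable A -> (mu A < +oo)%E -> forall eps : R, 0 < eps ->
    (fun n => mu (A `&` [set x | eps <= `|fn n x - f x|])) @ \oo --> 0%E.

Definition extended_form_exists (E : (X -> R) -> \bar R) : Prop :=
  forall (fn : nat -> X -> R) f,
    (forall n, L2 (fn n) /\ (E (fn n) < +oo)%E) -> L2 f -> (E f < +oo)%E ->
    loc_cvg_meas fn f -> (E f <= limn_einf (fun n => E (fn n)))%E.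

(* E_e: lower semicontinuous relaxation on L^0(mu) (measurable functions)
   w.r.t. local convergence in measure of E extended by +oo outside L^2. *)
Definition extended_form (E : (X -> R) -> \bar R) (f : X -> R) : \bar R :=
  ereal_inf [set limn_einf (fun n => E (fn n)) | fn in
    [set fn : nat -> X -> R | (forall n, L2 (fn n)) /\ loc_cvg_meas fn f]].

Definition L0 (f : X -> R) : Prop := measurable_fun setT f.

End Defs.

(* Main.v *)
Require Import Defs.
From HB Require Import structures.
From mathcomp Require Import all_boot all_order all_algebra.
From mathcomp Require Import all_classical all_reals all_analysis.
From mathcomp Require Import measurable_realfun ring lra.
Set Implicit Arguments. Unset Strict Implicit. Unset Printing Implicit Defensive.
Import Order.TTheory GRing.Theory Num.Theory.
Import numFieldNormedType.Exports.
Local Open Scope classical_set_scope.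
Local Open Scope ring_scope.

(** The resolvent [u = G_a f] is characterised by [f - a u] being a subgradient
of [E] at [u]; testing at [min] and [max] of two resolvents makes [G_a f]
monotone in [f] and, for [f >= 0], antitone in [a].

(i) => (ii): shrink [g] to [g' > 0] in L^2 with [<g', G_a g'> <= 1] for all [a].
The subgradient inequality at [|f|] reads
[<g' - a u, |f|> <= E f + <g', u>], and [a u -> 0] in L^2 because
[a ||u||^2 <= <g', u> <= 1]; hence [<g', |f|> <= E f + 1] and [w = g'/2] works.

(ii) => (i): convexity gives [int |f| w <= max 1 (E f)] on L^2. For [g <= w/2] in
L^2 and [u = G_a g] one gets [int u w <= 1 + E u <= 1 + <g, u> <= 1 + (int u w)/2],
so [int u w <= 2] uniformly in [a], and Fatou's lemma bounds the Green operator.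
The same estimate passes to [E_e] by Fatou along a.e. convergent subsequences. *)

(** * Limits inferior and a.e. convergence *)

Section limn_einf_bounds.
Context {R : realType}.
Implicit Types (u : (\bar R)^nat) (x : \bar R).
Local Open Scope ereal_scope.

Lemma einfs_le_limn_einf u n : einfs u n <= limn_einf u.
Proof.
rewrite limn_einf_lim.
have /ereal_nondecreasing_cvgn/cvg_lim -> // := nondecreasing_einfs u.
by apply: ereal_sup_ubound; exists n.
Qed.

Lemma limn_einf_lt_frequently u x : limn_einf u < x ->
  forall k, exists n, (k <= n)%N /\ u n < x.
Proof.
move=> ux k; have /ereal_inf_lt[y [n /= kn <-] ynx] :=
  le_lt_trans (einfs_le_limn_einf u k) ux.
by exists n.
Qed.

Lemma limn_einf_le_frequently u x :
  (forall k, exists n, (k <= n)%N /\ u n <= x) -> limn_einf u <= x.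
Proof.
move=> ux; rewrite limn_einf_lim.
have /ereal_nondecreasing_cvgn/cvg_lim -> // := nondecreasing_einfs u.
apply: ge_ereal_sup => _ [k _ <-]; have [n [kn]] := ux k; apply: le_trans.
by apply: ereal_inf_lbound; exists n.
Qed.

End limn_einf_bounds.

Section ae_convergence.
Context {d : measure_display} {X : measurableType d} {R : realType}.
Variable mu : {measure set X -> \bar R}.

(** This is Fatou's lemma for an a.e. limit: off a null set [f] coincides with the limit inferior of
    the [fn]. *)
Lemma fatou_le_bound (fn : nat -> X -> R) (f : X -> R) (C : \bar R) :
  (forall n, measurable_fun setT (fn n)) -> measurable_fun setT f ->
  (forall n x, 0 <= fn n x) -> (forall x, 0 <= f x) ->
  {ae mu, forall x, fn ^~ x @ \oo --> f x} ->
  (forall n, (\int[mu]_x (fn n x)%:E <= C)%E) ->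
  (\int[mu]_x (f x)%:E <= C)%E.
Proof.
move=> mfn mf fn0 f0 cvgf leC.
have mfnE n : measurable_fun setT (EFin \o fn n).
  exact/measurable_EFinP.
apply: (@le_trans _ _ (\int[mu]_x limn_einf (fun n => (fn n x)%:E))%E).
  apply: ae_ge0_le_integral => //.
  - by move=> x _; rewrite lee_fin.
  - exact/measurable_EFinP.
  - move=> x _; apply: le_trans (einfs_le_limn_einf _ 0).
    by apply: le_ereal_inf_tmp => _ [n _ <-]; rewrite lee_fin.
  - rewrite /limn_einf; apply: measurableT_comp => //.
    apply: (@measurable_fun_limn_esup _ _ _ _ (fun n x => - (fn n x)%:E)%E) => n.
    exact: (measurableT_comp _ (mfnE n)).
  - apply: filterS cvgf => x fx _.
    have /cvg_limn_einf_sup[-> _] : (fun n => (fn n x)%:E) @ \oo --> (f x)%:E.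
      by apply/fine_cvgP; split; first exact: nearW.
    exact: lexx.
apply: le_trans (fatou _ _ _ _) _ => //.
  by move=> n x _; rewrite lee_fin.
by apply: limn_einf_le_frequently => k; exists k.
Qed.

(** The bounds sum to 2, so the limit superior of the sets is null. This turns geometric rates into
    a.e. convergence, both for the completeness of $L^2$ and for local convergence in measure. *)
Lemma borel_cantelli (B : nat -> set X) :
  (forall n, measurable (B n)) -> (forall n, (mu (B n) <= (2^-1 ^+ n)%:E)%E) ->
  {ae mu, forall x, exists N, forall n, (N <= n)%N -> ~ B n x}.
Proof.
move=> mB muB.
have nB : mu.-negligible (lim_sup_set B).
  exists (lim_sup_set B); split => //.
    apply: bigcapT_measurable => k; apply: bigcup_measurable => j _; exact: mB.
  apply: lim_sup_set_cvg0 => //.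
  apply: (@le_lt_trans _ _ (\sum_(n <oo) (2^-1 ^+ n)%:E)%E).
    by apply: lee_nneseries => n _ //; rewrite measure_ge0.
  have /cvg_lim : (\sum_(0 <= i < n) (2^-1 ^+ i)%:E)%E @[n --> \oo] --> (2:R)%:E.
    have -> : (fun n => \sum_(0 <= i < n) (2^-1 ^+ i : R)%:E)%E =
              EFin \o series (geometric 1 (2^-1:R)).
      apply/funext => n /=; rewrite /series/= sumEFin; congr EFin.
      by apply: eq_bigr => i _; rewrite mul1r.
    apply/fine_cvgP; split; first exact: nearW.
    have := @cvg_geometric_series R 1 2^-1 _.
    rewrite (_ : 1 * (1 - 2^-1)^-1 = 2 :> R); last by field.
    by apply; rewrite ger0_norm ?invr_ge0//; lra.
  by move=> ->//; rewrite ltry.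
apply: negligibleS nB => x /= Hx k _.
apply: contrapT => Hk; apply: Hx; exists k => n kn Bn; apply: Hk.
by exists n.
Qed.

End ae_convergence.

(** * Square-integrable functions *)

Section L2_space.
Context {d : measure_display} {X : measurableType d} {R : realType}.
Variable mu : {measure set X -> \bar R}.
Implicit Types f g h : X -> R.

Definition ip f g : R := \int[mu]_x (f x * g x).

Lemma L2P f : L2 mu f <->
  measurable_fun setT f /\ mu.-integrable setT (EFin \o (fun x => f x ^+ 2)).
Proof.
split=> -[mf fi]; split=> //.
  apply/integrableP; split; first exact/measurable_EFinP/measurable_funX.
  under eq_integral do rewrite /= ger0_norm ?sqr_ge0//.
  exact: fi.
move/integrableP : fi => [_].
by under eq_integral do rewrite /= ger0_norm ?sqr_ge0//.
Qed.

Lemma L2_measurable f : L2 mu f -> measurable_fun setT f.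
Proof. by case. Qed.

Lemma L2_le f g : measurable_fun setT g -> L2 mu f ->
  (forall x, `|g x| <= `|f x|) -> L2 mu g.
Proof.
move=> mg /L2P[mf fi] gf; apply/L2P; split => //.
apply: (le_integrable measurableT _ _ fi).
  exact/measurable_EFinP/measurable_funX.
by move=> x _; rewrite lee_fin !normrX ler_pXn2r ?nnegrE.
Qed.

Lemma L2_lin a b f g : L2 mu f -> L2 mu g -> L2 mu (fun x => a * f x + b * g x).
Proof.
move=> /L2P[mf fi] /L2P[mg gi]; apply/L2P.
have mab : measurable_fun setT (fun x => a * f x + b * g x).
  by apply: measurable_funD; apply: measurable_funM.
split => //.
have := integrableD measurableT (integrableZl measurableT (2 * a ^+ 2) fi)
  (integrableZl measurableT (2 * b ^+ 2) gi).
apply: le_integrable => //.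
  exact/measurable_EFinP/measurable_funX.
move=> x _ /=; rewrite lee_fin ger0_norm ?sqr_ge0//.
apply: le_trans (ler_norm _); have := sqr_ge0 (a * f x - b * g x); nra.
Qed.

Lemma L2_scale a f : L2 mu f -> L2 mu (fun x => a * f x).
Proof.
move=> Lf; have := L2_lin a 0 Lf Lf.
by congr (L2 mu); apply/funext => x; rewrite mul0r addr0.
Qed.

Lemma L2_sub f g : L2 mu f -> L2 mu g -> L2 mu (fun x => f x - g x).
Proof.
move=> Lf Lg; have := L2_lin 1 (-1) Lf Lg.
by congr (L2 mu); apply/funext => x; ring.
Qed.

Lemma L2_add f g : L2 mu f -> L2 mu g -> L2 mu (fun x => f x + g x).
Proof.
move=> Lf Lg; have := L2_lin 1 1 Lf Lg.
by congr (L2 mu); apply/funext => x; ring.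
Qed.

Lemma L2_0 : L2 mu (fun=> 0).
Proof.
split => //; under eq_integral do rewrite expr0n/=.
by rewrite integral0 ltry.
Qed.

Lemma L2_abs f : L2 mu f -> L2 mu (fun x => `|f x|).
Proof.
move=> Lf; apply: (L2_le _ Lf) => [|x]; last by rewrite normr_id.
by apply: measurableT_comp => //; exact: L2_measurable.
Qed.

Lemma integrable_mul f g : L2 mu f -> L2 mu g ->
  mu.-integrable setT (EFin \o (fun x => f x * g x)).
Proof.
move=> /L2P[mf fi] /L2P[mg gi]; have := integrableD measurableT fi gi.
apply: le_integrable => //.
  exact/measurable_EFinP/measurable_funM.
move=> x _ /=; rewrite lee_fin; apply: le_trans (ler_norm _).
rewrite ler_norml; have := sqr_ge0 (f x - g x); have := sqr_ge0 (f x + g x).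
by move=> ? ?; apply/andP; split; nra.
Qed.

Lemma ipE f g : L2 mu f -> L2 mu g ->
  (\int[mu]_x (f x * g x)%:E)%E = (ip f g)%:E.
Proof.
move=> Lf Lg; rewrite /ip /Rintegral fineK//.
exact: integrable_fin_num (integrable_mul Lf Lg).
Qed.

Lemma ipC f g : ip f g = ip g f.
Proof. by apply: eq_Rintegral => x _; rewrite mulrC. Qed.

Lemma ip_linl a b f g h : L2 mu f -> L2 mu g -> L2 mu h ->
  ip (fun x => a * f x + b * g x) h = a * ip f h + b * ip g h.
Proof.
move=> Lf Lg Lh; rewrite /ip.
have fh := integrable_mul Lf Lh; have gh := integrable_mul Lg Lh.
rewrite -(RintegralZl a measurableT fh) -(RintegralZl b measurableT gh).
rewrite -RintegralD//.
- by apply: eq_Rintegral => x _; ring.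
- by have := integrableZl measurableT a fh; apply: eq_integrable.
- by have := integrableZl measurableT b gh; apply: eq_integrable.
Qed.

Lemma ip_linr a b f g h : L2 mu f -> L2 mu g -> L2 mu h ->
  ip h (fun x => a * f x + b * g x) = a * ip h f + b * ip h g.
Proof. by move=> *; rewrite ipC ip_linl// !(ipC h). Qed.

Lemma ipBl f g h : L2 mu f -> L2 mu g -> L2 mu h ->
  ip (fun x => f x - g x) h = ip f h - ip g h.
Proof.
move=> Lf Lg Lh; rewrite -[RHS](_ : 1 * ip f h + (-1) * ip g h = _); last by ring.
by rewrite -ip_linl//; congr ip; apply/funext => x; ring.
Qed.

Lemma ipBr f g h : L2 mu f -> L2 mu g -> L2 mu h ->
  ip h (fun x => f x - g x) = ip h f - ip h g.
Proof. by move=> *; rewrite ipC ipBl// !(ipC h). Qed.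

Lemma ipZl a f h : L2 mu f -> L2 mu h -> ip (fun x => a * f x) h = a * ip f h.
Proof.
move=> Lf Lh; rewrite -[RHS](_ : a * ip f h + 0 * ip f h = _); last by ring.
by rewrite -ip_linl//; congr ip; apply/funext => x; ring.
Qed.

Lemma ipZr a f h : L2 mu f -> L2 mu h -> ip h (fun x => a * f x) = a * ip h f.
Proof. by move=> *; rewrite ipC ipZl// (ipC h). Qed.

Lemma ip_ge0 f : 0 <= ip f f.
Proof. by apply: Rintegral_ge0 => x _; rewrite -expr2 sqr_ge0. Qed.

Lemma ip_ae_ge0 f g : L2 mu f -> L2 mu g ->
  {ae mu, forall x, 0 <= f x * g x} -> 0 <= ip f g.
Proof.
move=> Lf Lg fg0; rewrite /ip.
have mfg : measurable_fun setT (fun x => f x * g x).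
  by apply: measurable_funM; exact: L2_measurable.
(* [Rintegral_ge0] wants a pointwise sign, so the integrand is first replaced by its absolute value,
   to which it is a.e. equal. *)
have <- : \int[mu]_x `|f x * g x| = \int[mu]_x (f x * g x); last first.
  exact: Rintegral_ge0.
congr fine; apply: ae_eq_integral => //.
- by apply/measurable_EFinP; apply: measurableT_comp.
- exact/measurable_EFinP.
- by apply: filterS fg0 => x fgx _ /=; rewrite ger0_norm.
Qed.

Lemma ip_ae_eq0 f : L2 mu f -> ip f f <= 0 -> {ae mu, forall x, f x = 0}.
Proof.
move=> Lf ff0; have {}ff0 : ip f f = 0 by apply/le_anti; rewrite ff0 ip_ge0.
have mff : measurable_fun setT (EFin \o (fun x => f x * f x)).
  by apply/measurable_EFinP/measurable_funM; exact: L2_measurable.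
have := ipE Lf Lf; rewrite ff0 => int0.
have [/(_ _)/= + _] := ae_eq_integral_abs mu measurableT mff.
have -> : (\int[mu]_x `|(f x * f x)%:E| = 0)%E.
  by apply: etrans int0; apply: eq_integral => x _ /=; rewrite ger0_norm// -expr2 sqr_ge0.
move=> /(_ erefl); apply: filterS => x /(_ I)[]/eqP.
by rewrite mulf_eq0 => /orP[] /eqP.
Qed.

Lemma dist2E f g : L2 mu f -> L2 mu g ->
  dist2 mu f g = (ip (fun x => f x - g x) (fun x => f x - g x))%:E.
Proof. by move=> Lf Lg; rewrite -ipE//; exact: L2_sub. Qed.

Lemma ip_sqrB f g : L2 mu f -> L2 mu g ->
  ip (fun x => f x - g x) (fun x => f x - g x) = ip f f - 2 * ip f g + ip g g.
Proof.
move=> Lf Lg; rewrite ipBl ?ipBr//; last exact: L2_sub.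
by rewrite (ipC g f); ring.
Qed.

(** Expand $0\le\|cf-g\|^2$ and divide by $c$. This weighted form takes the place of the
    Cauchy-Schwarz inequality. *)
Lemma ip_AMGM c f g : 0 < c -> L2 mu f -> L2 mu g ->
  2 * ip f g <= c * ip f f + c^-1 * ip g g.
Proof.
move=> c0 Lf Lg; have := ip_ge0 (fun x => c * f x - g x).
rewrite ip_sqrB ?ipZl ?ipZr//; try exact: L2_scale.
move=> H; rewrite -(ler_pM2l c0) mulrDr mulVKf ?gt_eqF//; nra.
Qed.

End L2_space.

(** * Completeness of $L^2$ along rapidly Cauchy sequences *)

Section L2_complete.
Context {d : measure_display} {X : measurableType d} {R : realType}.
Variable mu : {measure set X -> \bar R}.

Lemma cvg_geometric_increments (u : nat -> R) N :
  (forall n, (N <= n)%N -> `|u n - u n.+1| < 2^-1 ^+ n) -> cvgn u.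
Proof.
move=> uN; pose v n := u (n + N)%N.
suff : cvgn v by move=> /cvg_ex[l vl]; apply/cvg_ex; exists l; rewrite -(cvg_shiftn N).
have -> : v = (fun n => v 0%N + series (fun k => v k.+1 - v k) n).
  apply/funext => n; rewrite /series/= telescope_sumr//; ring.
apply: is_cvgD; first exact: is_cvg_cst.
apply: normed_cvg.
apply: (@series_le_cvg _ _ (geometric 1 2^-1)) => //.
- by move=> n /=; exact: normr_ge0.
- by move=> n; rewrite /geometric/= mul1r exprn_ge0.
- move=> n; rewrite /geometric/= /v distrC mul1r; apply: ltW.
  apply: lt_le_trans (uN _ _) _; first by rewrite leq_addl.
  by rewrite addnC exprD ler_piMl ?exprn_ge0// exprn_ile1//; lra.
- by apply: is_cvg_geometric_series; rewrite ger0_norm ?invr_ge0//; lra.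
Qed.

Lemma measurable_ae_limit (h : nat -> X -> R) :
  (forall n, measurable_fun setT (h n)) -> {ae mu, forall x, cvgn (h ^~ x)} ->
  exists2 f : X -> R, measurable_fun setT f & {ae mu, forall x, h ^~ x @ \oo --> f x}.
Proof.
(* The limit superior is measurable on all of [X], and [fine] sends infinite values to 0, which is
   harmless off the convergence set. *)
move=> mh ch; exists (fun x => fine (limn_esup (fun n => (h n x)%:E))).
  apply: measurableT_comp => //.
  apply: (@measurable_fun_limn_esup _ _ _ _ (fun n x => (h n x)%:E)) => n.
  exact/measurable_EFinP.
apply: filterS ch => x /cvg_ex[/= l hl].
have /cvg_limn_einf_sup[_ ->] // : (fun n => (h n x)%:E) @ \oo --> l%:E.
by apply/fine_cvgP; split; first exact: nearW.
Qed.

(** Chebyshev's inequality for $f^2$ at level $e^2$. *)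
Lemma measure_ge_le_ip (f : X -> R) (e : R) : 0 < e -> L2 mu f ->
  (mu [set x | e <= `|f x|]%R * (e ^+ 2)%:E <= (ip mu f f)%:E)%E.
Proof.
move=> e0 Lf; have mff : measurable_fun setT (EFin \o (fun x => f x * f x)).
  by apply/measurable_EFinP/measurable_funM; exact: L2_measurable Lf.
have e20 : 0 < e ^+ 2 by rewrite exprn_gt0.
have -> : [set x | e <= `|f x|] =
    setT `&` [set x | ((e ^+ 2)%:E <= `|(EFin \o (fun x => f x * f x)%R) x|)%E].
  rewrite setTI; apply/seteqP; split => x /=;
    rewrite lee_fin normrM -expr2 ler_pXn2r ?nnegrE// ltW//.
rewrite muleC; apply: le_trans (le_integral_abse mu measurableT mff e20) _.
rewrite -ipE// le_eqVlt; apply/orP; left; apply/eqP/eq_integral => x _ /=.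
by rewrite ger0_norm// -expr2 sqr_ge0.
Qed.

(** With the rate $8^{-n}$, Chebyshev at level $2^{-n}$ leaves sets of measure at most
    $8^{-n}4^n=2^{-n}$. Borel-Cantelli then yields an a.e. limit, and Fatou carries the distance
    bounds over to it. *)
Lemma L2_complete (h : nat -> X -> R) : (forall n, L2 mu (h n)) ->
  (forall n m, (n <= m)%N ->
    ip mu (fun x => h n x - h m x) (fun x => h n x - h m x) <= 8^-1 ^+ n) ->
  exists2 f, L2 mu f &
    forall n, ip mu (fun x => h n x - f x) (fun x => h n x - f x) <= 8^-1 ^+ n.
Proof.
move=> Lh Ch.
have mh n : measurable_fun setT (h n) by exact: L2_measurable (Lh n).
pose B n := [set x | 2^-1 ^+ n <= `|h n x - h n.+1 x|].
have mB n : measurable (B n).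
  rewrite -[B n]setTI; apply: measurable_fun_le => //.
  by apply: measurableT_comp => //; exact: measurable_funB.
have muB n : (mu (B n) <= (2^-1 ^+ n)%:E)%E.
  have e0 : 0 < (2^-1 : R) ^+ n by rewrite exprn_gt0.
  have := measure_ge_le_ip e0 (L2_sub (Lh n) (Lh n.+1)).
  move=> H; have {H} := le_trans H (_ : _ <= (8^-1 ^+ n)%:E)%E.
  rewrite lee_fin Ch// => /(_ isT).
  rewrite -lee_pdivlMr ?exprn_gt0// => /le_trans; apply.
  rewrite lee_fin ler_pdivrMr ?exprn_gt0// -exprS -exprM mulnC exprM.
  by rewrite (_ : 2^-1 ^+ 3 = 8^-1)//; field.
have ch : {ae mu, forall x, cvgn (h ^~ x)}.
  apply: filterS (borel_cantelli mB muB) => x [N HN].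
  apply: (@cvg_geometric_increments _ N) => n Nn.
  by rewrite ltNge; apply/negP/HN.
have [f mf hf] := measurable_ae_limit mh ch.
have dist n : (\int[mu]_x ((h n x - f x) ^+ 2)%:E <= (8^-1 ^+ n)%:E)%E.
  apply: (@fatou_le_bound _ _ _ _ (fun m x => (h n x - h (m + n)%N x) ^+ 2)).
  - by move=> m; apply: measurable_funX; exact: measurable_funB.
  - by apply: measurable_funX; exact: measurable_funB.
  - by move=> m x; exact: sqr_ge0.
  - by move=> x; exact: sqr_ge0.
  - apply: filterS hf => x hx; rewrite /= [fun m => _](_ : _ =
      (fun m => (h n x - h (m + n)%N x) * (h n x - h (m + n)%N x))); last first.
      by apply/funext => m; rewrite expr2.
    have hn : h n x - h (m + n)%N x @[m --> \oo] --> h n x - f x.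
      by apply: cvgB; [exact: cvg_cst|rewrite (cvg_shiftn n (h^~ x))].
    by rewrite expr2; exact: cvgM.
  - move=> m; have := Ch n (m + n)%N (leq_addl _ _).
    rewrite -lee_fin -ipE; first by under eq_integral do rewrite -expr2.
      exact: L2_sub.
    exact: L2_sub.
have Lhf n : L2 mu (fun x => h n x - f x).
  split; first exact: measurable_funB.
  by apply: le_lt_trans (dist n) _; rewrite ltry.
exists f => [|n].
  have := L2_sub (Lh 0%N) (Lhf 0%N).
  by congr (L2 mu); apply/funext => x; ring.
by rewrite -lee_fin -ipE//; exact: dist.
Qed.

End L2_complete.

(** * Resolvents *)

Section resolvent.
Context {d : measure_display} {X : measurableType d} {R : realType}.
Variables (mu : {measure set X -> \bar R}) (E : (X -> R) -> \bar R).
Hypothesis HE : nonlinear_order_preserving_form mu E.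
Implicit Types (f g h u : X -> R) (a b : R).

(** This is the limit $t\to0$ in a minimality inequality along a segment, once it has been divided
    by $t$. *)
Lemma ge0_linear_near0 (A B : R) :
  (forall t, 0 < t <= 1 -> 0 <= A + t * B) -> 0 <= A.
Proof.
move=> H; rewrite leNgt; apply/negP => A0.
(* For this [t] the term [t * B] is at most [- A / 2], so [A + t * B] would be negative. *)
pose t := Num.min 1 (- A / (2 * (1 + `|B|))).
have B0 : 0 < 1 + `|B| by rewrite ltr_wpDr.
have t0 : 0 < t by rewrite lt_min ltr01 divr_gt0 ?oppr_gt0 ?mulr_gt0.
have := H t; rewrite t0 ge_min lexx/= => /(_ isT); apply/negP; rewrite -ltNge.
have : t * (2 * (1 + `|B|)) <= - A.
  by rewrite -ler_pdivlMr ?mulr_gt0// ge_min lexx orbT.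
have := ler_norm B; nra.
Qed.

Lemma form_fin h : L2 mu h -> (E h < +oo)%E -> E h = (fine (E h))%:E.
Proof.
by move=> Lh Eh; rewrite fineK// ge0_fin_numE//; exact: (nopf_ge0 HE).
Qed.

(** The order property for the pair $0,f$ together with symmetry gives $2\mathcal E(|f|)\le2\mathcal
    E(f)$. *)
Lemma form_abs f : L2 mu f -> (E (fun x => `|f x|)%R <= E f)%E.
Proof.
move=> Lf; have [Ef|] := ltP (E f) +oo%E; last first.
  by rewrite leye_eq => /eqP ->; rewrite leey.
have := nopf_order HE (@L2_0 _ _ _ mu) Lf.
rewrite (_ : (fun x => 0 + `|f x|) = (fun x => `|f x|)); last first.
  by apply/funext => x; rewrite add0r.
rewrite (_ : (fun x => 0 - `|f x|) = (fun x => - `|f x|)); last first.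
  by apply/funext => x; rewrite add0r.
rewrite (_ : (fun x => 0 + f x) = f); last by apply/funext => x; rewrite add0r.
rewrite (_ : (fun x => 0 - f x) = (fun x => - f x)); last first.
  by apply/funext => x; rewrite add0r.
rewrite !(nopf_sym HE) //; last exact: L2_abs.
rewrite (form_fin Lf Ef); have := nopf_ge0 HE (L2_abs Lf).
case: (E (fun x => `|f x|)) => [r| |]//=; rewrite -?EFinD ?lee_fin => r0; lra.
Qed.

Lemma resolvent_dist a f h : 0 < a -> L2 mu f -> L2 mu h ->
  ((a / 2)%R%:E * dist2 mu h (fun x => a^-1 * f x)%R)%E =
  (a / 2 * ip mu h h - ip mu f h + (2 * a)^-1 * ip mu f f)%:E.
Proof.
move=> a0 Lf Lh; have Lf' := L2_scale a^-1 Lf.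
rewrite dist2E// -EFinM ip_sqrB// !ipZl// ?ipZr// (ipC mu h f); congr EFin.
by field; rewrite gt_eqF.
Qed.

(** Forward: comparison with 0 makes $\mathcal E(u)$ finite, and comparison with $th+(1-t)u$ as
    $t\to0$ gives the subgradient inequality. Backward: the quadratic penalty exceeds its
    linearization at $u$ by $\frac a2\|h-u\|^2\ge0$. *)
Lemma is_resolventP a f u : 0 < a -> L2 mu f ->
  is_resolvent mu E a f u <->
  [/\ L2 mu u, (E u < +oo)%E & forall h, L2 mu h ->
     (E u + (ip mu (fun x => f x - a * u x)%R (fun x => h x - u x)%R)%:E <= E h)%E].
Proof.
move=> a0 Lf; split=> [[Lu um]|[Lu Eu usub]].
- have Eu : (E u < +oo)%E.
    have := um _ (@L2_0 _ _ _ mu); rewrite (nopf_0 HE) !resolvent_dist//; last exact: L2_0.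
    rewrite add0e; case: (E u) (nopf_ge0 HE Lu) => //= r _.
    by rewrite ltry.
  split => // h Lh; have [Eh|] := ltP (E h) +oo%E; last first.
    by rewrite leye_eq => /eqP ->; rewrite leey.
  rewrite (form_fin Lh Eh) (form_fin Lu Eu) -EFinD lee_fin.
  have Lau := L2_scale a Lu; have Lfu := L2_sub Lf Lau.
  rewrite ipBr// !ipBl// !ipZl//.
  (* [B] is $\frac a2\|h-u\|^2$, the second-order term of the penalty along the segment from $u$ to
     $h$. *)
  set B := a / 2 * (ip mu h h - 2 * ip mu u h + ip mu u u).
  rewrite -subr_ge0; apply: (@ge0_linear_near0 _ B) => t /andP[t0 t1].
  have Lt : L2 mu (fun x => t * h x + (1 - t) * u x) by exact: L2_lin.
  have t01 : 0 <= t <= 1 by rewrite ltW.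
  have := nopf_convex HE Lh Lu t01.
  have := um _ Lt; rewrite !resolvent_dist//.
  rewrite (form_fin Lh Eh) (form_fin Lu Eu).
  rewrite ip_linl// !ip_linr// (ipC mu h u).
  case: (E (fun x => t * h x + (1 - t) * u x)) => [r| |]//; rewrite -?EFinM -?EFinD ?lee_fin => H1 H2.
  rewrite -(pmulr_rge0 _ t0) /B; nra.
- split => // h Lh; have := usub _ Lh; rewrite !resolvent_dist//.
  have [Eh|] := ltP (E h) +oo%E; last first.
    by rewrite leye_eq => /eqP -> _; rewrite addye// leey.
  have Lau := L2_scale a Lu; have Lfu := L2_sub Lf Lau.
  rewrite (form_fin Lh Eh) (form_fin Lu Eu) -!EFinD !lee_fin.
  rewrite ipBr// !ipBl// !ipZl//.
  have := ip_ge0 mu (fun x => h x - u x); rewrite ip_sqrB// (ipC mu h u) => H1 H2.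
  have := mulr_ge0 (ltW a0) H1; lra.
Qed.

(* Testing the two subgradient inequalities at [min u1 u2] and [max u1 u2]. *)
Lemma resolvent_le a f1 f2 u1 u2 : 0 < a -> L2 mu f1 -> L2 mu f2 ->
  {ae mu, forall x, f1 x <= f2 x} ->
  is_resolvent mu E a f1 u1 -> is_resolvent mu E a f2 u2 ->
  {ae mu, forall x, u1 x <= u2 x}.
Proof.
move=> a0 Lf1 Lf2 f12 /is_resolventP[]// Lu1 Eu1 sub1 /is_resolventP[]// Lu2 Eu2 sub2.
(* Midpoint and half difference: $m\pm g$ are $u_1$ and $u_2$, while $m\mp|g|$ are their minimum and
   maximum. Below, [p] is the positive part of $u_1-u_2$. *)
pose m x := 2^-1 * u1 x + 2^-1 * u2 x.
pose g x := 2^-1 * u1 x + - 2^-1 * u2 x.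
have Lm : L2 mu m by exact: L2_lin.
have Lg : L2 mu g by exact: L2_lin.
have Lag := L2_abs Lg.
pose p x := `|g x| + g x.
have Lp : L2 mu p by exact: L2_add.
have Lmin := L2_sub Lm Lag; have Lmax := L2_add Lm Lag.
have Lau1 := L2_scale a Lu1; have Lau2 := L2_scale a Lu2.
have := nopf_order HE Lm Lg.
rewrite [X in (_ <= E X + _)%E -> _](_ : _ = u1); last first.
  by apply/funext => x; rewrite /m /g; field.
rewrite [X in (_ <= _ + E X)%E -> _](_ : _ = u2); last first.
  by apply/funext => x; rewrite /m /g; field.
have := sub1 _ Lmin; have := sub2 _ Lmax.
rewrite (_ : (fun x => m x + `|g x| - u2 x) = p); last first.
  by apply/funext => x; rewrite /p /m /g; field.
rewrite (_ : (fun x => m x - `|g x| - u1 x) = (fun x => (-1) * p x)); last first.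
  by apply/funext => x; rewrite /p /m /g; field.
rewrite ipZr// ?ipBl// ?ipZl//; last exact: L2_sub.
rewrite (form_fin Lu1 Eu1) (form_fin Lu2 Eu2).
move: (nopf_ge0 HE Lmin) (nopf_ge0 HE Lmax).
case: (E (fun x => m x - `|g x|)) => [r1| |]// _;
  case: (E (fun x => m x + `|g x|)) => [r2| |]// _; rewrite -?EFinD ?lee_fin// => H1 H2 H3.
have fp : 0 <= ip mu (fun x => f2 x - f1 x) p.
  apply: ip_ae_ge0 => //; first exact: L2_sub.
  apply: filterS f12 => x f12x; rewrite mulr_ge0 ?subr_ge0// /p.
  by have := ler_norm (- g x); rewrite normrN; lra.
(* Pairing $u_1-u_2$ with its positive part gives $\|p\|^2$. The two subgradient inequalities and
   the order property then add up to $a\|p\|^2\le-\langle f_2-f_1,p\rangle\le0$. *)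
have pp : ip mu u1 p - ip mu u2 p = ip mu p p.
  rewrite -ipBl//; apply: eq_Rintegral => x _; rewrite /p.
  have -> : u1 x - u2 x = 2 * g x by rewrite /g; field.
  have : `|g x| ^+ 2 = g x ^+ 2 by rewrite real_normK ?num_real.
  by nra.
have p0 : ip mu p p <= 0.
  rewrite ipBl// in fp; rewrite -pp -(pmulr_rle0 _ a0); lra.
apply: filterS (ip_ae_eq0 Lp p0) => x; rewrite /p /g => px.
by have := normr_ge0 (2^-1 * u1 x + - 2^-1 * u2 x); lra.
Qed.

(** Testing each subgradient inequality at the other resolvent and adding gives
    $a\|u_1-u_2\|^2\le\langle f_1-f_2,u_1-u_2\rangle$; [ip_AMGM] with weight $a$ concludes. *)
Lemma resolvent_contraction a f1 f2 u1 u2 : 0 < a -> L2 mu f1 -> L2 mu f2 ->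
  is_resolvent mu E a f1 u1 -> is_resolvent mu E a f2 u2 ->
  a ^+ 2 * ip mu (fun x => u1 x - u2 x) (fun x => u1 x - u2 x) <=
  ip mu (fun x => f1 x - f2 x) (fun x => f1 x - f2 x).
Proof.
move=> a0 Lf1 Lf2 /is_resolventP[]// Lu1 Eu1 sub1 /is_resolventP[]// Lu2 Eu2 sub2.
have Lau1 := L2_scale a Lu1; have Lau2 := L2_scale a Lu2.
have Lfu1 := L2_sub Lf1 Lau1; have Lfu2 := L2_sub Lf2 Lau2.
have := sub1 _ Lu2; have := sub2 _ Lu1.
rewrite (form_fin Lu1 Eu1) (form_fin Lu2 Eu2) -!EFinD !lee_fin.
move=> H1 H2; rewrite !ipBr// !ipBl// !ipZl// in H1 H2.
have := ip_AMGM a0 (L2_sub Lu1 Lu2) (L2_sub Lf1 Lf2).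
rewrite -(ler_pM2l a0) mulrDr mulVKf ?gt_eqF// => H3.
have : 0 <= a * (ip mu f1 u1 - ip mu f1 u2 - ip mu f2 u1 + ip mu f2 u2 -
  a * (ip mu u1 u1 - 2 * ip mu u1 u2 + ip mu u2 u2)).
  by rewrite pmulr_rge0// (ipC mu u1 u2) in H1 H2 *; rewrite (ipC mu u2 u1) in H1 H2 *; lra.
have e : ip mu (fun x => u1 x - u2 x) (fun x => f1 x - f2 x) =
    ip mu f1 u1 - ip mu f1 u2 - (ip mu f2 u1 - ip mu f2 u2).
  rewrite ipBr//; last exact: L2_sub.
  by rewrite !ipBl// (ipC mu u1 f1) (ipC mu u1 f2) (ipC mu u2 f1) (ipC mu u2 f2).
move: H3; rewrite e !ip_sqrB// => H3 H4; lra.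
Qed.

Lemma resolvent0 a : 0 < a -> is_resolvent mu E a (fun=> 0) (fun=> 0).
Proof.
move=> a0; apply/is_resolventP => //; first exact: L2_0.
have L0 := @L2_0 _ _ _ mu.
split => //; first by rewrite (nopf_0 HE) ltry.
move=> h Lh; rewrite (nopf_0 HE) add0e.
rewrite (_ : ip mu _ _ = 0) ?(nopf_ge0 HE)//.
rewrite [LHS](_ : _ = ip mu (fun x => 0 * h x) h); first by rewrite ipZl// mul0r.
by apply: eq_Rintegral => x _; ring.
Qed.

Lemma resolvent_ge0 a f u : 0 < a -> L2 mu f -> {ae mu, forall x, 0 <= f x} ->
  is_resolvent mu E a f u -> {ae mu, forall x, 0 <= u x}.
Proof.
move=> a0 Lf f0; apply: (resolvent_le a0 _ _ f0) (resolvent0 a0) => //.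
exact: L2_0.
Qed.

(** The resolvent identity: the subgradient condition sees only $f-au$, which equals
    $(f-(a-b)u)-bu$. *)
Lemma resolvent_shift a b f u : 0 < a -> 0 < b -> L2 mu f ->
  is_resolvent mu E a f u -> is_resolvent mu E b (fun x => f x - (a - b) * u x) u.
Proof.
move=> a0 b0 Lf /is_resolventP[]// Lu Eu su; apply/is_resolventP => //.
  by apply: L2_sub => //; exact: L2_scale.
split => // h Lh; rewrite (_ : (fun x => _ - b * u x) = (fun x => f x - a * u x)).
  exact: su.
by apply/funext => x; ring.
Qed.

(** By the resolvent identity $u_a$ is the $b$-resolvent of $f-(a-b)u_a$, which is at most $f$
    because $u_a\ge0$; monotonicity in the datum applies. *)
Lemma resolvent_antitone a b f ua ub : 0 < b -> b <= a -> L2 mu f ->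
  {ae mu, forall x, 0 <= f x} ->
  is_resolvent mu E a f ua -> is_resolvent mu E b f ub ->
  {ae mu, forall x, ua x <= ub x}.
Proof.
move=> b0 ba Lf f0 Ra Rb; have a0 : 0 < a by exact: lt_le_trans ba.
have Lua : L2 mu ua by case: Ra.
apply: (resolvent_le b0 _ Lf _ (resolvent_shift a0 b0 Lf Ra) Rb).
  by apply: L2_sub => //; exact: L2_scale.
apply: filterS (resolvent_ge0 a0 Lf f0 Ra) => x ux.
by rewrite lerBlDr lerDl mulr_ge0// subr_ge0.
Qed.

End resolvent.

(** * Existence of resolvents by the direct method *)

Section resolvent_existence.
Context {d : measure_display} {X : measurableType d} {R : realType}.
Variables (mu : {measure set X -> \bar R}) (E : (X -> R) -> \bar R).
Hypothesis HE : nonlinear_order_preserving_form mu E.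

(* Uniform convexity of [J h = E h + a/2 ||h - f/a||^2]: the parallelogram law
   bounds the distance of two approximate minimizers. *)
Lemma approx_minimizers_close (a r e : R) (f p q : X -> R) : 0 < a -> L2 mu f ->
  L2 mu p -> L2 mu q ->
  (forall h, L2 mu h ->
    (r%:E <= E h + (a / 2)%R%:E * dist2 mu h (fun x => a^-1 * f x)%R)%E) ->
  (E p + (a / 2)%R%:E * dist2 mu p (fun x => a^-1 * f x)%R <= (r + e)%:E)%E ->
  (E q + (a / 2)%R%:E * dist2 mu q (fun x => a^-1 * f x)%R <= (r + e)%:E)%E ->
  a / 8 * ip mu (fun x => p x - q x) (fun x => p x - q x) <= e.
Proof.
move=> a0 Lf Lp Lq rmin; rewrite !resolvent_dist// => Jp Jq.
have Lm : L2 mu (fun x => 2^-1 * p x + (1 - 2^-1) * q x) by exact: L2_lin.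
have half : 0 <= (2^-1 : R) <= 1 by apply/andP; split; lra.
have := nopf_convex HE Lp Lq half; have := rmin _ Lm; rewrite resolvent_dist//.
have Ep : (E p < +oo)%E.
  by case: (E p) Jp (nopf_ge0 HE Lp) => //= s _; rewrite ltry.
have Eq : (E q < +oo)%E.
  by case: (E q) Jq (nopf_ge0 HE Lq) => //= s _; rewrite ltry.
rewrite (form_fin HE Lp Ep) -EFinD lee_fin in Jp.
rewrite (form_fin HE Lq Eq) -EFinD lee_fin in Jq.
rewrite (form_fin HE Lp Ep) (form_fin HE Lq Eq) ip_sqrB//.
rewrite ip_linl// !ip_linr// (ipC mu q p).
case: (E (fun x => 2^-1 * p x + (1 - 2^-1) * q x)) => [s| |]//.
rewrite -!EFinM -!EFinD !lee_fin => H1 H2; nra.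
Qed.

Lemma resolvent_exists a (f : X -> R) : 0 < a -> L2 mu f ->
  exists u, is_resolvent mu E a f u.
Proof.
move=> a0 Lf.
pose J h := (E h + (a / 2)%R%:E * dist2 mu h (fun x => a^-1 * f x)%R)%E.
pose S := [set J h | h in L2 mu].
have J0 h : L2 mu h -> (0 <= J h)%E.
  move=> Lh; apply: adde_ge0; first exact: (nopf_ge0 HE).
  apply: mule_ge0; first by rewrite lee_fin divr_ge0// ltW.
  by apply: integral_ge0 => x _; rewrite lee_fin sqr_ge0.
have [r Sr] : exists r, ereal_inf S = r%:E.
  have : (0 <= ereal_inf S)%E by apply: le_ereal_inf_tmp => _ [h Lh <-]; exact: J0.
  have : (ereal_inf S < +oo)%E.
    apply: (@le_lt_trans _ _ (J (fun=> 0))).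
      by apply: ereal_inf_lbound; exists (fun=> 0) => //; exact: L2_0.
    by rewrite /J (nopf_0 HE) add0e resolvent_dist ?ltry//; exact: L2_0.
  by case: (ereal_inf S) => // r; exists r.
have rmin h : L2 mu h -> (r%:E <= J h)%E.
  by move=> Lh; rewrite -Sr; apply: ereal_inf_lbound; exists h.
(* The tolerance $\frac a8 8^{-n}$ cancels the factor $\frac a8$ of [approx_minimizers_close] and
   leaves the rate $8^{-n}$ that [L2_complete] asks for. *)
have /choice[h hP] : forall n : nat, exists h,
    L2 mu h /\ (J h <= (r + a / 8 * 8^-1 ^+ n)%:E)%E.
  move=> n; have e0 : 0 < a / 8 * 8^-1 ^+ n by rewrite mulr_gt0 ?divr_gt0 ?exprn_gt0.
  have : (ereal_inf S < (r + a / 8 * 8^-1 ^+ n)%:E)%E by rewrite Sr lte_fin ltrDl.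
  by move=> /ereal_inf_lt[_ [h Lh <-] /ltW]; exists h.
have Lh n : L2 mu (h n) by case: (hP n).
have [u Lu hu] : exists2 u, L2 mu u & forall n,
    ip mu (fun x => h n x - u x) (fun x => h n x - u x) <= 8^-1 ^+ n.
  apply: L2_complete => // n m nm.
  have [_ Jn] := hP n; have [_ Jm] := hP m.
  have a8 : 0 < a / 8 by rewrite divr_gt0.
  rewrite -(ler_pM2l a8); apply: (approx_minimizers_close a0 Lf (Lh n) (Lh m) rmin Jn).
  apply: le_trans Jm _; rewrite lee_fin lerD2l ler_pM2l//.
  by rewrite ler_wiXn2l ?invr_ge0//; lra.
exists u; split => // k Lk; apply: le_trans (rmin _ Lk).
rewrite resolvent_dist//; set qu := (X in (_ + X%:E)%E).
have Lau := L2_scale a Lu; have Lv := L2_sub Lau Lf.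
pose K := ip mu (fun x => a * u x - f x) (fun x => a * u x - f x).
(* The penalty at $h_n$ falls below [qu] by at most $\langle au-f,u-h_n\rangle$, where $au-f$ is its
   gradient at $u$. AM-GM with weight $2^{-n}$ bounds this pairing, since
   $\|u-h_n\|^2\le8^{-n}\le4^{-n}$. *)
have Eh n : (E (h n) <= (r - qu + 2^-1 ^+ n * (K + 1 + a))%:E)%E.
  have [_ ] := hP n; rewrite /J resolvent_dist//.
  have := nopf_ge0 HE (Lh n); case: (E (h n)) => [s| |]// _; rewrite -EFinD !lee_fin.
  have c0 : 0 < (2^-1 : R) ^+ n by rewrite exprn_gt0.
  have := ip_AMGM c0 Lv (L2_sub Lu (Lh n)).
  have := hu n; have := ip_ge0 mu (fun x => h n x - u x).
  rewrite (_ : ip mu (fun x => u x - h n x) _ =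
    ip mu (fun x => h n x - u x) (fun x => h n x - u x)); last first.
    by apply: eq_Rintegral => x _; ring.
  have -> : ip mu (fun x => a * u x - f x) (fun x => u x - h n x) =
      a * ip mu u u - a * ip mu u (h n) - ip mu f u + ip mu f (h n).
    by rewrite ipBr// !ipBl// !ipZl//; ring.
  rewrite -/K /qu ip_sqrB// (ipC mu (h n) u).
  set D := ip mu (h n) (h n) - _ + _ => D0 D8 H1 H2.
  have D4 : (2^-1 ^+ n)^-1 * D <= 2^-1 ^+ n.
    rewrite ler_pdivrMl//; apply: le_trans D8 _.
    rewrite -exprMn; apply: lerXn2r; rewrite ?nnegrE ?invr_ge0//; lra.
  have K0 : 0 <= K by exact: ip_ge0.
  have e82 : (8^-1 : R) ^+ n <= 2^-1 ^+ n.
    by apply: lerXn2r; rewrite ?nnegrE ?invr_ge0//; lra.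
  have : a / 8 * 8^-1 ^+ n <= a / 8 * 2^-1 ^+ n by rewrite ler_pM2l// divr_gt0.
  have := mulr_ge0 (ltW a0) D0; have := mulr_ge0 (ltW c0) K0; have := mulr_gt0 c0 a0.
  by rewrite /D; lra.
(* Lower semicontinuity along $h_n\to u$, with the error in [Eh] tending to 0. *)
have Eu : (E u <= (r - qu)%:E)%E.
  apply/lee_addgt0Pr => e e0; rewrite -EFinD.
  apply: le_trans (nopf_lsc HE Lh Lu _) _.
    rewrite (_ : (fun n => dist2 mu (h n) u) = EFin \o
      (fun n => ip mu (fun x => h n x - u x) (fun x => h n x - u x))); last first.
      by apply/funext => n; rewrite dist2E.
    apply/fine_cvgP; split; first exact: nearW.
    apply: (@squeeze_cvgr _ _ _ _ (fun=> 0) (fun n => 8^-1 ^+ n)).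
    - by apply: nearW => n; rewrite ip_ge0 hu.
    - exact: cvg_cst.
    - by apply: cvg_expr; rewrite ger0_norm ?invr_ge0//; lra.
  have : (fun n => 2^-1 ^+ n * (K + 1 + a)) @ \oo --> 0.
    rewrite -[X in _ --> X](mul0r (K + 1 + a)); apply: cvgM; last exact: cvg_cst.
    by apply: cvg_expr; rewrite ger0_norm ?invr_ge0//; lra.
  move=> /cvgrPdist_lt/(_ e e0)[N _ HN].
  apply: limn_einf_le_frequently => j; exists (maxn N j); split; first exact: leq_maxr.
  apply: le_trans (Eh _) _; rewrite lee_fin lerD2l; apply: ltW.
  have := HN (maxn N j) (leq_maxl _ _); rewrite /= sub0r normrN.
  exact/le_lt_trans/ler_norm.
by apply: le_trans (leeD2r _ Eu) _; rewrite -EFinD lee_fin subrK.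
Qed.

End resolvent_existence.

(** * Weights and the Luxemburg seminorm *)

Section weights.
Context {d : measure_display} {X : measurableType d} {R : realType}.
Variable mu : {measure set X -> \bar R}.

(** The weight is $\sum_n c_n1_{F_n}$ for a cover by sets of finite measure. The choice
    $c_n=2^{-(n+1)}/(1+\mu(F_n))$ keeps both $c_n$ and $c_n\mu(F_n)$ below $2^{-(n+1)}$, so the sum
    and its integral are at most 1. *)
Lemma sigma_finite_weight : sigma_finite setT mu ->
  exists phi : X -> R, [/\ measurable_fun setT phi, (forall x, 0 < phi x <= 1) &
    (\int[mu]_x (phi x)%:E <= 1)%E].
Proof.
move=> /sigma_finiteP[F [TF _ Ffin]].
have mF n : measurable (F n) by case: (Ffin n).
pose m n := fine (mu (F n)).
have muF n : mu (F n) = (m n)%:E by rewrite fineK// ge0_fin_numE//; case: (Ffin n).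
have m0 n : 0 <= m n by rewrite -lee_fin -muF.
pose c n : R := (1 / (2 ^ n.+1)%:R) / (1 + m n).
have c0 n : 0 < c n by rewrite !divr_gt0 ?ltr0n ?expn_gt0// ltr_wpDr.
have cle n (y : R) : 0 <= y <= 1 + m n -> c n * y <= 1 / (2 ^ n.+1)%:R.
  move=> /andP[y0 y1]; rewrite /c mulrAC ler_pdivrMr ?ltr_wpDr//.
  by rewrite ler_pM2l// divr_gt0// ltr0n expn_gt0.
pose t n x : \bar R := (c n * \1_(F n) x)%:E.
have t0 n x : (0 <= t n x)%E by rewrite lee_fin mulr_ge0// ltW.
have mt n : measurable_fun setT (t n).
  by apply/measurable_EFinP/measurable_funM => //; exact: measurable_indic.
pose psi x : \bar R := (\sum_(n <oo) t n x)%E.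
have psi1 x : (psi x <= 1)%E.
  apply: le_trans (@epsilon_trick0 R 1 xpredT ler01).
  apply: lee_nneseries => // n _; rewrite lee_fin cle// indicE.
  by case: (_ \in _) => /=; rewrite ?ler01 ?lexx ?lerDl ?addr_ge0 ?m0.
have psi0 x : (0 < psi x)%E.
  have [n _ Fnx] : (\bigcup_i F i) x by rewrite -TF.
  apply: (@lt_le_trans _ _ (t n x)).
    by rewrite lte_fin indicE mem_set// mulr1.
  apply: le_trans (@nneseries_lim_ge _ (t^~ x) xpredT 0 n.+1 _) => //.
  by rewrite big_nat_recr//= leeDr// sume_ge0.
have psiE x : psi x = (fine (psi x))%:E.
  rewrite fineK// ge0_fin_numE; first exact: le_lt_trans (psi1 x) (ltry _).
  exact: ltW.
exists (fun x => fine (psi x)); split.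
- apply: measurableT_comp => //.
  exact: (@ge0_emeasurable_sum _ _ _ _ t xpredT).
- by move=> x; rewrite -lte_fin -lee_fin -psiE psi0 psi1.
- under eq_integral do rewrite -psiE.
  rewrite integral_nneseries//.
  apply: le_trans (@epsilon_trick0 R 1 xpredT ler01).
  apply: lee_nneseries => [n _ _|n _]; first exact: integral_ge0.
  rewrite (_ : (\int[mu]_x t n x)%E = (c n * m n)%:E).
    by rewrite lee_fin; apply: cle; rewrite m0/= lerDr ler01.
  rewrite /t; under eq_integral do rewrite EFinM.
  rewrite ge0_integralZl_EFin//; last 2 first.
    exact/measurable_EFinP/measurable_indic.
    exact: ltW.
  by rewrite integral_indic// setIT muF.
Qed.

Lemma L2_weight (phi : X -> R) : measurable_fun setT phi ->
  (forall x, 0 < phi x <= 1) -> (\int[mu]_x (phi x)%:E <= 1)%E -> L2 mu phi.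
Proof.
move=> mphi phi01 iphi; split => //; apply: le_lt_trans (ltry 1).
apply: le_trans iphi; apply: ge0_le_integral => //.
- by move=> x _; rewrite lee_fin sqr_ge0.
- exact/measurable_EFinP/measurable_funX.
- exact/measurable_EFinP.
- by move=> x _; have := phi01 x; rewrite lee_fin expr2 => /andP[? ?]; nra.
Qed.

End weights.

(** * Weighted bounds for the form and its extension *)

Section luxemburg_bounds.
Context {d : measure_display} {X : measurableType d} {R : realType}.
Variables (mu : {measure set X -> \bar R}) (E : (X -> R) -> \bar R).
Hypothesis HE : nonlinear_order_preserving_form mu E.
Implicit Types (f g h u w : X -> R).

Lemma form_scale f t : L2 mu f -> 0 <= t <= 1 ->
  (E (fun x => t * f x)%R <= t%:E * E f)%E.
Proof.
move=> Lf t01; have := nopf_convex HE Lf (@L2_0 _ _ _ mu) t01.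
rewrite (nopf_0 HE) mule0 adde0.
by congr (E _ <= _)%E; apply/funext => x; rewrite mulr0 addr0.
Qed.

Lemma modular_space_fin f : L2 mu f -> (E f < +oo)%E -> modular_space (L2 mu) E f.
Proof.
move=> Lf Ef; split => //; have EfE := form_fin HE Lf Ef.
apply: (@squeeze_cvge _ _ _ _ (fun=> 0%E) _ (fun t => (t * fine (E f))%:E)).
- near=> t; have t0 : 0 < t by near: t; exact: nbhs_right_gt.
  have t1 : t <= 1 by near: t; exact: nbhs_right_le.
  rewrite (nopf_ge0 HE)/=; last exact: L2_scale.
  by rewrite EFinM -EfE; apply: form_scale => //; rewrite ltW.
- exact: cvg_cst.
- apply/fine_cvgP; split; first exact: nearW.
  rewrite -[X in _ --> X](mul0r (fine (E f))); apply: cvgM; last exact: cvg_cst.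
  exact: cvg_at_right_filter cvg_id.
Unshelve. all: by end_near. Qed.

(** For $l=\max(1,\mathcal E(f))$, convexity and $\mathcal E(0)=0$ give $\mathcal E(f/l)\le\mathcal
    E(f)/l\le1$. *)
Lemma luxemburg_le f : L2 mu f -> (luxemburg E f <= maxe 1 (E f))%E.
Proof.
move=> Lf; have [Ef|] := ltP (E f) +oo%E; last first.
  by rewrite leye_eq => /eqP ->; rewrite maxey leey.
have EfE := form_fin HE Lf Ef.
have -> : maxe 1%E (E f) = (Num.max 1 (fine (E f)))%:E by rewrite {1}EfE EFin_max.
set l := Num.max _ _; apply: ereal_inf_lbound; exists l => //=.
have l1 : 1 <= l by rewrite le_max lexx.
have l0 : 0 < l by exact: lt_le_trans l1.
split => //; apply: le_trans (form_scale Lf _) _.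
  by rewrite invr_ge0 ltW//= invf_le1.
by rewrite EfE -EFinM lee_fin mulrC ler_pdivrMr// mul1r le_max lexx orbT.
Qed.

Lemma weighted_le w f : L2 mu f ->
  (forall g, modular_space (L2 mu) E g ->
    (\int[mu]_x (`|g x| * w x)%:E <= luxemburg E g)%E) ->
  (\int[mu]_x (`|f x| * w x)%:E <= maxe 1 (E f))%E.
Proof.
move=> Lf Hw; have [Ef|] := ltP (E f) +oo%E; last first.
  by rewrite leye_eq => /eqP ->; rewrite maxey leey.
exact: le_trans (Hw _ (modular_space_fin Lf Ef)) (luxemburg_le Lf).
Qed.

(** On the $k$-th set of an increasing exhaustion, pick an index whose deviation exceeds $2^{-k}$
    only on measure $2^{-k}$, and apply Borel-Cantelli. The predicate [P] keeps the choice among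
    indices of low energy; the chosen indices need not increase. *)
Lemma loc_cvg_meas_ae_subseq (fn : nat -> X -> R) f (P : nat -> Prop) :
  sigma_finite setT mu -> (forall n, measurable_fun setT (fn n)) ->
  measurable_fun setT f -> loc_cvg_meas mu fn f ->
  (forall k, exists n, (k <= n)%N /\ P n) ->
  exists s : nat -> nat, (forall k, P (s k)) /\
    {ae mu, forall x, (fun k => fn (s k) x) @ \oo --> f x}.
Proof.
move=> /sigma_finiteP[F [TF Fle Ffin]] mfn mf fnf Pfreq.
pose B k n := F k `&` [set x | 2^-1 ^+ k <= `|fn n x - f x|].
have /choice[s sP] : forall k, exists n, P n /\ (mu (B k n) <= (2^-1 ^+ k)%:E)%E.
  move=> k; have e0 : 0 < (2^-1 : R) ^+ k by rewrite exprn_gt0.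
  have [mFk Fkfin] := Ffin k.
  have /fine_cvgP[[N1 _ HN1] /cvgrPdist_lt/(_ _ e0)[N2 _ HN2]] := fnf _ mFk Fkfin _ e0.
  have [n [Nn Pn]] := Pfreq (maxn N1 N2); exists n; split => //.
  have N1n : (N1 <= n)%N by apply: leq_trans Nn; exact: leq_maxl.
  have N2n : (N2 <= n)%N by apply: leq_trans Nn; exact: leq_maxr.
  have := HN1 _ N1n; have := HN2 _ N2n; rewrite /= sub0r normrN => H /fineK <-.
  by rewrite lee_fin ltW//; exact: le_lt_trans (ler_norm _) H.
exists s; split; first by move=> k; case: (sP k).
have mB k : measurable (B k (s k)).
  apply: measurableI; first by case: (Ffin k).
  rewrite -[X in measurable X]setTI; apply: measurable_fun_le => //.
  by apply: measurableT_comp => //; exact: measurable_funB.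
have muB k : (mu (B k (s k)) <= (2^-1 ^+ k)%:E)%E by case: (sP k).
apply: filterS (borel_cantelli mB muB) => x [N HN].
have [K _ FKx] : (\bigcup_i F i) x by rewrite -TF.
apply/cvgrPdist_lt => e e0.
have : (fun n => (2^-1 : R) ^+ n) @ \oo --> 0.
  by apply: cvg_expr; rewrite ger0_norm ?invr_ge0//; lra.
move=> /cvgrPdist_lt/(_ e e0)[M _ HM].
exists (maxn N (maxn K M)) => // k /=; rewrite !geq_max => /and3P[Nk Kk Mk].
have := HM k Mk; rewrite /= sub0r normrN; apply: le_lt_trans.
apply: le_trans (ler_norm _); rewrite distrC ltW// ltNge; apply/negP => H.
apply: (HN k Nk); split => //.
by have /subsetPset := Fle _ _ Kk; apply.
Qed.

Lemma extended_weighted_le w f : sigma_finite setT mu ->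
  measurable_fun setT w -> (forall x, 0 < w x) ->
  (forall g, modular_space (L2 mu) E g ->
    (\int[mu]_x (`|g x| * w x)%:E <= luxemburg E g)%E) ->
  measurable_fun setT f ->
  (\int[mu]_x (`|f x| * w x)%:E <= luxemburg (extended_form mu E) f)%E.
Proof.
move=> sf mw w0 Hw mf; apply: le_ereal_inf_tmp => _ [l [l0 El] <-].
have mabs g : measurable_fun setT g -> measurable_fun setT (fun x => `|g x| * w x).
  by move=> mg; apply: measurable_funM => //; exact: measurableT_comp.
have mlf : measurable_fun setT (fun x => l^-1 * f x) by exact: measurable_funM.
(* By homogeneity it suffices to treat $f/l$, whose extended energy is at most 1. *)
suff : (\int[mu]_x (`|l^-1 * f x| * w x)%:E <= 1)%E.
  have -> : (\int[mu]_x (`|f x| * w x)%:E =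
      l%:E * \int[mu]_x (`|l^-1 * f x| * w x)%:E)%E.
    rewrite -ge0_integralZl_EFin//; last 3 first.
    - by move=> x _; rewrite lee_fin mulr_ge0// ltW.
    - exact/measurable_EFinP/mabs.
    - exact: ltW.
    apply: eq_integral => x _; rewrite -EFinM normrM gtr0_norm ?invr_gt0//.
    by congr EFin; field; rewrite gt_eqF.
  by move=> H; rewrite -[leRHS]mule1; apply: lee_wpmul2l => //; rewrite lee_fin ltW.
apply/lee_addgt0Pr => e e0.
(* The slack [e] gives an approximating sequence with infinitely many energies below $1+e$. An a.e.
   convergent selection of those terms has weighted integrals at most $1+e$, and Fatou applies. *)
have /ereal_inf_lt[_ [fn [Lfn fnf] <-] Efn] : (extended_form mu E (fun x => l^-1 * f x)%R < 1 + e%:E)%E.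
  by apply: le_lt_trans El _; rewrite -EFinD lte_fin ltrDl.
have mfn n : measurable_fun setT (fn n) by exact: L2_measurable (Lfn n).
have [s [Es sf']] := loc_cvg_meas_ae_subseq sf mfn mlf fnf (limn_einf_lt_frequently Efn).
apply: (@fatou_le_bound _ _ _ _ (fun k x => `|fn (s k) x| * w x)).
- by move=> k; exact: mabs.
- exact: mabs.
- by move=> k x; rewrite mulr_ge0// ltW.
- by move=> x; rewrite mulr_ge0// ltW.
- apply: filterS sf' => x fx; apply: cvgM; last exact: cvg_cst.
  exact: cvg_norm.
- move=> k; apply: le_trans (weighted_le (Lfn (s k)) Hw) _.
  by rewrite ge_max (ltW (Es k)) andbT leeDl// lee_fin ltW.
Qed.

End luxemburg_bounds.

(** * The Green operator *)

Section green_operator.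
Context {d : measure_display} {X : measurableType d} {R : realType}.
Variables (mu : {measure set X -> \bar R}) (E : (X -> R) -> \bar R).
Hypothesis HE : nonlinear_order_preserving_form mu E.
Implicit Types (f g h u w : X -> R).

Lemma resolvent_energy a f u : 0 < a -> L2 mu f -> is_resolvent mu E a f u ->
  (E u + (a * ip mu u u)%:E <= (ip mu f u)%:E)%E.
Proof.
move=> a0 Lf /is_resolventP[]// Lu Eu /(_ _ (@L2_0 _ _ _ mu)).
rewrite (form_fin HE Lu Eu) (nopf_0 HE) -!EFinD !lee_fin.
rewrite (_ : (fun x => 0 - u x) = (fun x => (-1) * u x)); last first.
  by apply/funext => x; ring.
have Lau := L2_scale a Lu.
rewrite ipZr// ?ipBl// ?ipZl//; last exact: L2_sub.
lra.
Qed.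

(** This shows that the extension by monotone limits agrees with the resolvent on $L^2$. Dominated
    convergence gives $f_n\to f$ in $L^2$, the contraction estimate gives $g_n\to u$ in $L^2$, and
    monotonicity in $n$ upgrades this to a.e. convergence. *)
Lemma resolvent_monotone_cvg a f u (fn gn : nat -> X -> R) : 0 < a ->
  L2 mu f -> is_resolvent mu E a f u ->
  (forall n, L2 mu (fn n)) -> (forall n x, 0 <= fn n x <= fn n.+1 x) ->
  (forall x, fn ^~ x @ \oo --> f x) ->
  (forall n, is_resolvent mu E a (fn n) (gn n)) ->
  {ae mu, forall x, gn ^~ x @ \oo --> u x}.
Proof.
move=> a0 Lf Ru Lfn fnS fnf Rgn.
have Lu : L2 mu u by case: Ru.
have Lgn n : L2 mu (gn n) by case: (Rgn n).
have fn_nd x : nondecreasing_seq (fn ^~ x).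
  by apply/nondecreasing_seqP => n; case/andP: (fnS n x).
have fn_le n x : fn n x <= f x.
  rewrite -(cvg_lim (@Rhausdorff R) (fnf x)).
  by apply: nondecreasing_cvgn_le => //; apply/cvg_ex; exists (f x).
have gn_nd n : {ae mu, forall x, gn n x <= gn n.+1 x}.
  apply: (resolvent_le HE a0 (Lfn n) (Lfn n.+1) _ (Rgn n) (Rgn n.+1)).
  by apply: aeW => x; case/andP: (fnS n x).
have gn_le n : {ae mu, forall x, gn n x <= u x}.
  apply: (resolvent_le HE a0 (Lfn n) Lf _ (Rgn n) Ru).
  by apply: aeW => x; exact: fn_le.
have Lfnf n : L2 mu (fun x => fn n x - f x) by exact: L2_sub.
have Lgnu n : L2 mu (fun x => gn n x - u x) by exact: L2_sub.
have fn_cvg : (fun n => ip mu (fun x => fn n x - f x) (fun x => fn n x - f x)) @ \oo --> 0.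
  have [|//|||_ _] := @dominated_convergence _ _ _ mu setT measurableT
    (fun n x => ((fn n x - f x) * (fn n x - f x))%:E) (cst 0%E)
    (EFin \o (fun x => f x * f x)) _ _ _ (integrable_mul Lf Lf) _.
  - move=> n; apply/measurable_EFinP/measurable_funM; exact: L2_measurable (Lfnf n).
  - apply: aeW => x _; apply/fine_cvgP; split; first exact: nearW.
    rewrite -[X in _ --> X](mul0r 0) -(subrr (f x)).
    by apply: cvgM; (apply: cvgB; [exact: fnf|exact: cvg_cst]).
  - apply: aeW => x n _; rewrite lee_fin.
    have := fn_le n x; have /andP[? _] := fnS n x => ?.
    by rewrite ger0_norm -?expr2 ?sqr_ge0//; nra.
  rewrite integral_cst// mul0e => /fine_cvgP[_].
  by apply: cvg_trans; apply: near_eq_cvg; apply: nearW => n; rewrite /= ipE.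
(* [B j] collects the points where no $g_n$ comes within $1/(j+1)$ of $u$; Chebyshev makes it null.
   Since $g_n$ increases below $u$, coming close once means staying close. *)
pose B j := \bigcap_n [set x | j.+1%:R^-1 <= `|gn n x - u x|].
have mA j n : measurable [set x | j.+1%:R^-1 <= `|gn n x - u x|].
  rewrite -[X in measurable X]setTI; apply: measurable_fun_le => //.
  by apply: measurableT_comp => //; exact: L2_measurable (Lgnu n).
have muB j : mu (B j) = 0%E.
  apply/le_anti/andP; split => //; apply/lee_addgt0Pr => e e0; rewrite add0e.
  pose c : R := j.+1%:R^-1 ^+ 2.
  have c0 : 0 < c by rewrite exprn_gt0// invr_gt0.
  have ce0 : 0 < c * a ^+ 2 * e by rewrite !mulr_gt0 ?exprn_gt0.
  have /cvgrPdist_lt/(_ _ ce0)[N _ /(_ N (leqnn N))] := fn_cvg.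
  rewrite /= sub0r normrN ger0_norm ?ip_ge0// => HN.
  have := resolvent_contraction HE a0 (Lfn N) Lf (Rgn N) Ru => Hc.
  have j0 : 0 < (j.+1%:R^-1 : R) by rewrite invr_gt0.
  have := measure_ge_le_ip j0 (Lgnu N); rewrite -/c => HB.
  apply: (@le_trans _ _ (mu [set x | j.+1%:R^-1 <= `|gn N x - u x|])).
    apply: le_measure; rewrite ?inE//; last by move=> x; apply.
    exact: bigcapT_measurable.
  rewrite -(@lee_pmul2r _ c%:E)// -EFinM; apply: le_trans HB _.
  rewrite lee_fin -(ler_pM2l (exprn_gt0 2 a0)); apply: le_trans Hc _.
  by apply: le_trans (ltW HN) _; rewrite le_eqVlt; apply/orP; left; apply/eqP; ring.
have aeB : {ae mu, forall x, forall j, ~ B j x}.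
  apply/ae_foralln => j; exists (B j); split => //; first exact: bigcapT_measurable.
  by move=> x /= /contrapT.
move/ae_foralln in gn_nd; move/ae_foralln in gn_le.
apply: filterS3 gn_nd gn_le aeB => x ndx lex Bx.
have {}ndx : nondecreasing_seq (gn ^~ x) by exact/nondecreasing_seqP.
apply/cvgrPdist_lt => e e0.
have [M _ /(_ M (leqnn M)) HM] := near_infty_natSinv_lt (PosNum e0).
have [N HN] : exists N, ~ (M.+1%:R^-1 <= `|gn N x - u x|).
  by apply: contrapT => /forallNP H; apply: (Bx M) => n _ /=; apply: contrapT; exact: H.
exists N => // n /= Nn.
have := ndx _ _ Nn; have := lex n; have := lex N => H1 H2 H3.
rewrite ger0_norm ?subr_ge0//; apply: le_lt_trans HM.
apply: (@le_trans _ _ (u x - gn N x)); first by lra.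
move/negP: HN; rewrite -ltNge distrC ger0_norm ?subr_ge0//; exact: ltW.
Qed.

(** The constant 2 comes from absorbing: $I\le1+\frac12I$ for the weighted integral $I$. This is
    legitimate because $I\le1+\mathcal E(u)$ is finite. *)
Lemma resolvent_weight_bound a w g u : 0 < a -> L2 mu g ->
  measurable_fun setT w -> (forall x, 0 < w x) ->
  (forall x, 0 <= g x <= w x / 2) ->
  (forall f, modular_space (L2 mu) E f ->
    (\int[mu]_x (`|f x| * w x)%:E <= luxemburg E f)%E) ->
  is_resolvent mu E a g u ->
  (\int[mu]_x (`|u x| * w x)%:E <= 2%:E)%E.
Proof.
move=> a0 Lg mw w0 gw Hw Ru.
have [Lu Eu _] := (is_resolventP HE u a0 Lg).1 Ru.
have mu' := L2_measurable Lu; have mg := L2_measurable Lg.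
have mgu : measurable_fun setT (fun x => 2%:E * (g x * u x)%:E)%E.
  by apply: emeasurable_funM => //; apply/measurable_EFinP/measurable_funM.
have muw : measurable_fun setT (fun x => `|u x| * w x).
  by apply: measurable_funM => //; exact: measurableT_comp.
set I := (\int[mu]_x _)%E.
have I0 : (0 <= I)%E by apply: integral_ge0 => x _; rewrite lee_fin mulr_ge0// ltW.
have IE : (I <= 1 + E u)%E.
  apply: le_trans (weighted_le HE Lu Hw) _.
  rewrite ge_max leeDl ?(nopf_ge0 HE)//= leeDr//.
have guI : ((2 * ip mu g u)%:E <= I)%E.
  rewrite EFinM -ipE// -integralZl//; last exact: integrable_mul.
  apply: le_trans (lee_abs _) _.
  apply: le_trans (le_abse_integral _ _ _) _ => //.
  apply: ge0_le_integral => //.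
  - exact: measurableT_comp.
  - exact/measurable_EFinP.
  - move=> x _; rewrite -EFinM /= lee_fin !normrM ger0_norm//.
    have /andP[g0 g2] := gw x; rewrite (ger0_norm g0).
    by have := normr_ge0 (u x); nra.
have := resolvent_energy a0 Lg Ru; move: IE guI I0.
rewrite (form_fin HE Lu Eu) -!EFinD.
have := mulr_ge0 (ltW a0) (ip_ge0 mu u).
case: I => [r| |]//; rewrite -?EFinD !lee_fin => ? ? ? ? ?; lra.
Qed.

(* Along a sequence [b n -> 0] that need not be monotone, an antitone family is
   squeezed between its values at the points [1/(k+1)]. *)
Lemma antitone_family_cvg (s t b : nat -> R) (M : R) :
  nondecreasing_seq s -> (forall k, s k <= M) -> (forall n, 0 < b n) ->
  b @ \oo --> 0 ->
  (forall n k, b n <= k.+1%:R^-1 -> s k <= t n) ->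
  (forall n k, k.+1%:R^-1 <= b n -> t n <= s k) ->
  (fun n => (t n)%:E) @ \oo --> ereal_sup (range (EFin \o s)).
Proof.
move=> nds sM b0 bcvg st ts.
have cs : cvgn s by apply: nondecreasing_is_cvgn => //; exists M => _ [k _ <-].
have sl k : s k <= limn s by exact: nondecreasing_cvgn_le.
have -> : ereal_sup (range (EFin \o s)) = (limn s)%:E.
  have /ereal_nondecreasing_cvgn/cvg_lim <- // : nondecreasing_seq (EFin \o s).
    by move=> m n mn; rewrite lee_fin nds.
  by apply/cvg_lim => //; apply/fine_cvgP; split; first exact: nearW.
apply/fine_cvgP; split; first exact: nearW.
have tl n : t n <= limn s.
  have [K _ /(_ K (leqnn K))/ltW HK] := near_infty_natSinv_lt (PosNum (b0 n)).
  exact: le_trans (ts _ _ HK) (sl K).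
apply/cvgrPdist_lt => e e0.
have /cvgrPdist_lt/(_ e e0)[K _ /(_ K (leqnn K)) HK] := cs.
have k0 : 0 < (K.+1%:R^-1 : R) by rewrite invr_gt0.
have /cvgrPdist_lt/(_ _ k0)[N _ HN] := bcvg.
exists N => // n Nn /=; have := HN n Nn; rewrite /= sub0r normrN gtr0_norm// => /ltW bn.
have := st _ _ bn; have := tl n; move: HK; rewrite /= !ger0_norm ?subr_ge0//.
by move=> ? ? ?; lra.
Qed.

Lemma green_finite w : sigma_finite setT mu ->
  measurable_fun setT w -> (forall x, 0 < w x) ->
  (forall f, modular_space (L2 mu) E f ->
    (\int[mu]_x (`|f x| * w x)%:E <= luxemburg E f)%E) ->
  exists g : X -> R, measurable_fun setT g /\ (forall x, 0 < g x) /\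
    exists v, is_green mu E (fun x => (g x)%:E) v /\
      {ae mu, forall x, (v x < +oo)%E}.
Proof.
move=> sf mw w0 Hw; have [phi [mphi phi01 iphi]] := sigma_finite_weight sf.
have Lphi := L2_weight mphi phi01 iphi.
(* The bound by [w x / 2] serves the absorbing estimate, and the bound by [phi] puts [g] in
   $L^2$. *)
pose g x := Num.min (w x / 2) (phi x).
have g0 x : 0 < g x by rewrite lt_min divr_gt0//=; case/andP: (phi01 x).
have mg : measurable_fun setT g.
  by apply: measurable_minr => //; exact: measurable_funM.
have Lg : L2 mu g.
  apply: (L2_le mg Lphi) => x; rewrite !gtr0_norm// ?ge_min ?lexx ?orbT//.
  by case/andP: (phi01 x).
have gw x : 0 <= g x <= w x / 2 by rewrite ltW//= ge_min lexx.
have /choice[U UP] : forall a, exists u, 0 < a -> is_resolvent mu E a g u.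
  move=> a; have [a0|] := ltP 0 a; last by exists (fun=> 0).
  by have [u Ru] := resolvent_exists HE a0 Lg; exists u.
pose c k : R := k.+1%:R^-1.
have c0 k : 0 < c k by rewrite invr_gt0.
pose v x := ereal_sup (range (EFin \o (fun k => U (c k) x))).
have ag0 : {ae mu, forall x, 0 <= g x} by apply: aeW => x; exact: ltW.
have ULe a b : 0 < b -> b <= a -> {ae mu, forall x, U a x <= U b x}.
  move=> b0 ba; apply: (resolvent_antitone HE b0 ba Lg ag0); apply: UP => //.
  exact: lt_le_trans ba.
have Und : {ae mu, forall x, nondecreasing_seq (fun k => U (c k) x)}.
  have /ae_foralln : forall k, {ae mu, forall x, U (c k) x <= U (c k.+1) x}.
    by move=> k; apply: ULe => //; rewrite lef_pV2 ?posrE// ler_nat.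
  by apply: filterS => x H; exact/nondecreasing_seqP.
have U0 : {ae mu, forall x, forall k, 0 <= U (c k) x}.
  by apply/ae_foralln => k; exact: (resolvent_ge0 HE (c0 k) Lg ag0 (UP _ (c0 k))).
have mU k : measurable_fun setT (U (c k)) by case: (UP _ (c0 k)) => /L2_measurable.
pose h k x := (`|U (c k) x| * w x)%:E.
have mh k : measurable_fun setT (h k).
  by apply/measurable_EFinP/measurable_funM => //; exact: measurableT_comp.
have h0 k x : (0 <= h k x)%E by rewrite lee_fin mulr_ge0// ltW.
(* Fatou bounds the integral of the limit inferior, which is therefore finite a.e. *)
have ih : (\int[mu]_x limn_einf (h^~ x) <= 2%:E)%E.
  apply: le_trans (fatou _ _ _ _) _ => //.
  apply: limn_einf_le_frequently => k; exists k; split => //.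
  exact: (resolvent_weight_bound (c0 k) Lg mw w0 gw Hw (UP _ (c0 k))).
have hfin : {ae mu, forall x, (limn_einf (h^~ x) < +oo)%E}.
  have h0' x : (0 <= limn_einf (h^~ x))%E.
    apply: le_trans (einfs_le_limn_einf _ 0).
    by apply: le_ereal_inf_tmp => _ [n _ <-].
  have : mu.-integrable setT (fun x => limn_einf (h^~ x)).
    apply/integrableP; split.
      rewrite /limn_einf; apply: measurableT_comp => //.
      apply: (@measurable_fun_limn_esup _ _ _ _ (fun n x => - h n x)%E) => n.
      exact: (measurableT_comp _ (mh n)).
    under eq_integral do rewrite gee0_abs//.
    exact: le_lt_trans ih (ltry _).
  move=> /(integrable_ae measurableT); apply: filterS => x /(_ I).
  by rewrite ge0_fin_numE.
have Ubd : {ae mu, forall x, exists M, forall k, U (c k) x <= M}.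
  apply: filterS3 Und U0 hfin => x nd u0 hx.
  have [M HM] : exists M, (limn_einf (h^~ x) < M%:E)%E.
    case: (limn_einf _) hx => [r| |]// _; first by exists (r + 1); rewrite lte_fin ltrDl.
    by exists 0; rewrite ltNyr.
  (* Some later index has its weighted value below [M]; as the sequence is nondecreasing, this
     bounds the $k$-th term too. *)
  exists (M / w x) => k; have [n [kn]] := limn_einf_lt_frequently HM k.
  rewrite lte_fin -ltr_pdivlMr// => /ltW; apply: le_trans.
  exact: le_trans (nd _ _ kn) (ler_norm _).
exists g; split => //; split => //; exists v; split; last first.
  apply: filterS Ubd => x [M HM]; apply: le_lt_trans (ltry M).
  by apply: ge_ereal_sup => _ [k _ <-]; rewrite lee_fin.
exists (fun a x => (U a x)%:E); split.
  move=> a a0 fn gn Lfn fnS fnf Rgn.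
  have fnf' x : fn ^~ x @ \oo --> g x by have /fine_cvgP[] := fnf x.
  have := resolvent_monotone_cvg a0 Lg (UP _ a0) Lfn fnS fnf' Rgn.
  by apply: filterS => x Hx; apply/fine_cvgP; split; first exact: nearW.
(* Comparing [b n] with [c k] involves countably many pairs, so a single null set serves for all of
   them. *)
move=> b b0 bcvg.
have st : {ae mu, forall x n k, b n <= c k -> U (c k) x <= U (b n) x}.
  apply/ae_foralln => n; apply/ae_foralln => k.
  have [bc|/negP bc] := boolP (b n <= c k); last by apply: aeW.
  by apply: filterS (ULe _ _ (b0 n) bc) => x H _.
have ts : {ae mu, forall x n k, c k <= b n -> U (b n) x <= U (c k) x}.
  apply/ae_foralln => n; apply/ae_foralln => k.
  have [bc|/negP bc] := boolP (c k <= b n); last by apply: aeW.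
  by apply: filterS (ULe _ _ (c0 k) bc) => x H _.
apply: filterS2 (filterI Und Ubd) (filterI st ts) => x [nd [M HM]] [stx tsx].
exact: (antitone_family_cvg nd HM b0 bcvg stx tsx).
Qed.

End green_operator.

(** * From a finite Green operator to a weight *)

Section weight_of_green.
Context {d : measure_display} {X : measurableType d} {R : realType}.
Variables (mu : {measure set X -> \bar R}) (E : (X -> R) -> \bar R).
Hypothesis HE : nonlinear_order_preserving_form mu E.
Implicit Types (f g h u w : X -> R).

(* Since [a ||u_a||^2 <= <g, u_a>] stays bounded, [a <u_a, |f|>] vanishes as
   [a -> 0] in the subgradient inequality tested with [|f|]. *)
Lemma bounded_resolvents_weight g (u : nat -> X -> R) : L2 mu g ->
  (forall n, is_resolvent mu E n.+1%:R^-1 g (u n)) ->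
  (forall n, ip mu g (u n) <= 1) ->
  forall f, L2 mu f -> ((ip mu g (fun x => `|f x|)%R)%:E <= 1 + E f)%E.
Proof.
move=> Lg Ru gu f Lf; pose F x := `|f x|; have LF : L2 mu F := L2_abs Lf.
have [Ef|] := ltP (E f) +oo%E; last first.
  by rewrite leye_eq => /eqP ->; rewrite addey// leey.
apply/lee_addgt0Pr => e e0.
rewrite -/F; pose K := ip mu F F + 1.
have K0 : 0 < K by rewrite ltr_wpDl// ip_ge0.
(* For $a<e^2/K$ one has $\frac ae\|f\|^2\le e$, and AM-GM with weight $e$ gives $a\langle
   u,|f|\rangle\le e$. The 1 in [K] keeps the quotient meaningful when $\|f\|=0$. *)
have d0 : 0 < e ^+ 2 / K by rewrite divr_gt0// exprn_gt0.
have [n _ /(_ n (leqnn n)) /=] := near_infty_natSinv_lt (PosNum d0).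
pose a : R := n.+1%:R^-1; rewrite -/a => an; have a0 : 0 < a by rewrite invr_gt0.
have [Lu Eu /(_ _ LF)] := (is_resolventP HE (u n) a0 Lg).1 (Ru n).
have := resolvent_energy HE a0 Lg (Ru n).
have := form_abs HE Lf; rewrite (form_fin HE Lf Ef) -/F => EF.
have EFfin : (E F < +oo)%E by exact: le_lt_trans EF (ltry _).
move: EF; rewrite (form_fin HE Lu Eu) (form_fin HE LF EFfin) -!EFinD !lee_fin.
have Lau := L2_scale a Lu; have Lgu := L2_sub Lg Lau.
rewrite ipBr// !ipBl// !ipZl// => EF H1 H2.
have Eu0 : 0 <= fine (E (u n)) by rewrite fine_ge0// (nopf_ge0 HE).
have uu : a * ip mu (u n) (u n) <= 1 by have := gu n; lra.
have H3 := ip_AMGM e0 Lu LF.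
have H4 : a * (e^-1 * ip mu F F) <= e.
  have : a * K <= e ^+ 2 by rewrite -ler_pdivlMr// ltW.
  rewrite (_ : a * (_ * _) = a * ip mu F F / e); last by ring.
  by rewrite ler_pdivrMr// /K; lra.
have H5 : a * (2 * ip mu (u n) F) <= e * (a * ip mu (u n) (u n)) + a * (e^-1 * ip mu F F).
  by rewrite [e * _]mulrCA -(mulrDr a) ler_pM2l.
have H6 : e * (a * ip mu (u n) (u n)) <= e by rewrite -[leRHS]mulr1 ler_pM2l.
have := gu n; have := mulr_ge0 (ltW a0) (ip_ge0 mu (u n)); lra.
Qed.

Lemma green_weight g v : sigma_finite setT mu ->
  measurable_fun setT g -> (forall x, 0 < g x) ->
  is_green mu E (fun x => (g x)%:E) v -> {ae mu, forall x, (v x < +oo)%E} ->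
  exists w, measurable_fun setT w /\ (forall x, 0 < w x) /\
    forall f, modular_space (L2 mu) E f ->
      (\int[mu]_x (`|f x| * w x)%:E <= luxemburg E f)%E.
Proof.
move=> sf mg g0 [u [uext uv]] vfin.
have [phi [mphi phi01 iphi]] := sigma_finite_weight sf.
have phi0 x : 0 < phi x by case/andP: (phi01 x).
have Lphi := L2_weight mphi phi01 iphi.
(* These $L^2$ truncations increase to $g$, as the monotone extension of the resolvent requires. *)
pose f_ k x := Num.min (g x) (k.+1%:R * phi x).
have f0 k x : 0 < f_ k x by rewrite lt_min g0 mulr_gt0.
have Lf k : L2 mu (f_ k).
  apply: (L2_le _ (L2_scale k.+1%:R Lphi)) => [|x].
    by apply: measurable_minr => //; exact: measurable_funM.
  by rewrite !gtr0_norm ?mulr_gt0// ge_min lexx orbT.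
have fS k x : 0 <= f_ k x <= f_ k.+1 x.
  rewrite (ltW (f0 k x))/= le_min !ge_min lexx/= orbC ler_pM2r ?ler_nat//.
  by rewrite leqnSn.
have fcvg x : (fun k => (f_ k x)%:E) @ \oo --> (g x)%:E.
  apply: cvg_near_cst; exists (Num.bound (g x / phi x)) => // k /= Nk.
  congr EFin; apply/min_idPl; rewrite -ler_pdivrMr//.
  have gp : 0 <= g x / phi x by rewrite divr_ge0 ?ltW.
  apply: le_trans (ltW (archi_boundP gp)) _.
  by rewrite ler_nat (leq_trans Nk).
pose c n : R := n.+1%:R^-1.
have c0 n : 0 < c n by rewrite invr_gt0.
have ccvg : c @ \oo --> 0.
  apply/cvgrPdist_lt => e e0; have := near_infty_natSinv_lt (PosNum e0).
  by apply: filterS => n; rewrite /= sub0r normrN gtr0_norm// invr_gt0.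
have cS n m : (n <= m)%N -> c m <= c n by move=> nm; rewrite lef_pV2 ?posrE// ler_nat.
have /choice[G GP] : forall p : nat * nat, exists h, is_resolvent mu E (c p.1) (f_ p.2) h.
  by move=> p; exact: (resolvent_exists HE (c0 p.1) (Lf p.2)).
have Gk n : {ae mu, forall x, nondecreasing_seq (fun k => G (n, k) x)}.
  have /ae_foralln : forall k, {ae mu, forall x, G (n, k) x <= G (n, k.+1) x}.
    move=> k; apply: (resolvent_le HE (c0 n) (Lf k) (Lf k.+1) _ (GP (n, k)) (GP (n, k.+1))).
    by apply: aeW => x; case/andP: (fS k x).
  by apply: filterS => x H; exact/nondecreasing_seqP.
have Gn : {ae mu, forall x, nondecreasing_seq (fun n => G (n, 0%N) x)}.
  have /ae_foralln : forall n, {ae mu, forall x, G (n, 0%N) x <= G (n.+1, 0%N) x}.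
    move=> n; apply: (resolvent_antitone HE (c0 n.+1) (cS _ _ (leqnSn n)) (Lf 0%N) _
      (GP (n, 0%N)) (GP (n.+1, 0%N))).
    by apply: aeW => x; exact: ltW.
  by apply: filterS => x H; exact/nondecreasing_seqP.
(* The approximants increase in $k$ to the extended resolvent, so the one with $k=0$ lies below
   it. *)
have Gu : {ae mu, forall x n, ((G (n, 0%N) x)%:E <= u (c n) x)%E}.
  apply/ae_foralln => n.
  have := uext _ (c0 n) f_ (fun k => G (n, k)) Lf fS fcvg (fun k => GP (n, k)).
  apply: filterS2 (Gk n) => x nd; apply: cvge_ge.
  by apply: nearW => k; rewrite lee_fin nd.
have Gv : {ae mu, forall x, nondecreasing_seq (fun n => G (n, 0%N) x) /\
    exists M, forall n, G (n, 0%N) x <= M}.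
  apply: filterS3 (filterI Gn Gu) (uv c c0 ccvg) vfin => x [nd Gux] uvx vx.
  split => //; exists (fine (v x)) => n.
  have nv : ((G (n, 0%N) x)%:E <= v x)%E.
    apply: cvge_ge uvx; exists n => // m /= nm.
    by apply: le_trans (Gux m); rewrite lee_fin nd.
  rewrite -lee_fin fineK// fin_numElt vx andbT.
  exact: lt_le_trans (ltNyr _) nv.
have mG n : measurable_fun setT (G (n, 0%N)) by case: (GP (n, 0%N)) => /L2_measurable.
have Gc : {ae mu, forall x, cvgn (fun n => G (n, 0%N) x)}.
  apply: filterS Gv => x [nd [M HM]].
  by apply: nondecreasing_is_cvgn => //; exists M => _ [n _ <-].
(* [V] is a measurable, real-valued substitute for [v], whose measurability [is_green] does not
   assert. *)
have [V mV GV] := measurable_ae_limit mG Gc.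
have GleV : {ae mu, forall x n, G (n, 0%N) x <= V x}.
  apply: filterS2 Gv GV => x [nd _] Vx n.
  rewrite -(cvg_lim (@Rhausdorff R) Vx).
  by apply: nondecreasing_cvgn_le => //; apply/cvg_ex; exists (V x).
(* Since $g'\le f_0$, its resolvents stay below $V\le e^{|V|}$. The factor $e^{-|V|}$ then makes
   $g'U_n\le\phi$ a.e., whose integral is at most 1. *)
pose g' x := Num.min (f_ 0%N x) (phi x * expR (- `|V x|)).
have g'0 x : 0 < g' x by rewrite lt_min f0 mulr_gt0 ?expR_gt0.
have mg' : measurable_fun setT g'.
  apply: measurable_minr; first exact: L2_measurable (Lf 0%N).
  apply: measurable_funM => //; apply: (measurableT_comp (@measurable_expR R)).
  by apply: measurableT_comp => //; exact: measurableT_comp.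
have Lg' : L2 mu g'.
  by apply: (L2_le mg' (Lf 0%N)) => x; rewrite !gtr0_norm// ge_min lexx.
have /choice[U UP] : forall n, exists h, is_resolvent mu E (c n) g' h.
  by move=> n; exact: (resolvent_exists HE (c0 n) Lg').
have LU n : L2 mu (U n) by case: (UP n).
have gU n : ip mu g' (U n) <= 1.
  rewrite -lee_fin; apply: le_trans iphi; rewrite -ipE//.
  have UG : {ae mu, forall x, U n x <= G (n, 0%N) x}.
    apply: (resolvent_le HE (c0 n) Lg' (Lf 0%N) _ (UP n) (GP (n, 0%N))).
    by apply: aeW => x; rewrite ge_min lexx.
  have U0 : {ae mu, forall x, 0 <= U n x}.
    apply: (resolvent_ge0 HE (c0 n) Lg' _ (UP n)).
    by apply: aeW => x; exact: ltW.
  apply: le_trans (lee_abs _) _; apply: le_trans (le_abse_integral _ _ _) _ => //.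
    by apply/measurable_EFinP/measurable_funM => //; exact: L2_measurable (LU n).
  apply: ae_ge0_le_integral => //.
  - apply: measurableT_comp => //.
    by apply/measurable_EFinP/measurable_funM => //; exact: L2_measurable (LU n).
  - by move=> x _; rewrite lee_fin ltW.
  - exact/measurable_EFinP.
  - apply: filterS3 UG U0 GleV => x UGx U0x /(_ n) GVx _ /=; rewrite lee_fin.
    rewrite normrM gtr0_norm// ger0_norm//.
    have UV : U n x <= expR `|V x|.
      by have := expR_ge1Dx `|V x|; have := ler_norm (V x); lra.
    apply: le_trans (_ : phi x * expR (- `|V x|) * expR `|V x| <= _).
      by apply: ler_pM => //; [exact: ltW|rewrite ge_min lexx orbT].
    by rewrite expRN divfK// gt_eqF// expR_gt0.
have bound := bounded_resolvents_weight Lg' UP gU.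
(* If $\mathcal E(f/l)\le1$, then [bound] gives $\langle g',|f|/l\rangle\le2$; halving $g'$ turns
   this into $\int|f|w\,d\mu\le l$. *)
exists (fun x => g' x / 2); split; first exact: measurable_funM.
split=> [x|f [Lff _]]; first exact: divr_gt0.
apply: le_ereal_inf_tmp => _ [l [l0 El] <-].
have Lfl := L2_scale l^-1 Lff; have La := L2_abs Lfl.
have := le_trans (bound _ Lfl) (leeD2l 1 El).
rewrite -EFinD lee_fin => H.
have -> : (\int[mu]_x (`|f x| * (g' x / 2))%:E)%E =
    (l / 2 * ip mu g' (fun x => `|l^-1 * f x|))%:E.
  rewrite EFinM -ipE// -integralZl//; last exact: integrable_mul.
  apply: eq_integral => x _; rewrite -EFinM normrM gtr0_norm ?invr_gt0//.
  by congr EFin; field; rewrite gt_eqF.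
rewrite lee_fin; nra.
Qed.

End weight_of_green.

Theorem theorem4p6 (d : measure_display) (X : measurableType d) (R : realType)
  (mu : {measure set X -> \bar R}) (E : (X -> R) -> \bar R) :
  sigma_finite setT mu ->
  nonlinear_order_preserving_form mu E ->
  ((exists g : X -> R, measurable_fun setT g /\ (forall x, 0 < g x) /\
      exists v, is_green mu E (fun x => (g x)%:E) v /\
                {ae mu, forall x, (v x < +oo)%E})
   <->
   (exists w : X -> R, measurable_fun setT w /\ (forall x, 0 < w x) /\
      forall f, modular_space (L2 mu) E f ->
        (\int[mu]_x (`|f x| * w x)%:E <= luxemburg E f)%E))
  /\
  (extended_form_exists mu E ->
   forall w : X -> R, measurable_fun setT w -> (forall x, 0 < w x) ->
     (forall f, modular_space (L2 mu) E f ->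
        (\int[mu]_x (`|f x| * w x)%:E <= luxemburg E f)%E) ->
     forall f, modular_space (@L0 _ _ R) (extended_form mu E) f ->
        (\int[mu]_x (`|f x| * w x)%:E <= luxemburg (extended_form mu E) f)%E).
Proof.
move=> sf HE; split; first split.
- by move=> [g [mg [g0 [v [gv vfin]]]]]; exact: green_weight gv vfin.
- by move=> [w [mw [w0 Hw]]]; exact: green_finite Hw.
- by move=> _ w mw w0 Hw f [mf _]; exact: extended_weighted_le.
Qed.
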